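(* Let $(\mathfrak g,\omega_{\mathfrak g})$ be a restricted orthosymplectic quasi-Frobenius Lie superalgebra. Suppose there exists an even non-zero $x\in([\mathfrak g,\mathfrak g]_{\mathfrak g})^\perp$ such that $\mathscr K:=\mathrm{Span}\{x\}$ is an ideal and $\mathscr K^\perp$ is a $p$-ideal. Then $(\mathfrak g,\omega_{\mathfrak g})$ is obtained as a symplectic $\mathscr D_{\bar 0}$-extension by a 1-dimensional space from a restricted orthosymplectic quasi-Frobenius Lie superalgebra $(\mathfrak a,\omega_{\mathfrak a})$. Moreover, if $\mathfrak z_{\bar 0}(\mathfrak g)\neq0$ (the even part of the center), then $x$ can be chosen in $\mathfrak z_{\bar 0}(\mathfrak g)$, so that the double extension is classical.
   Context: $\mathbb K$ is a field of characteristic $p>2$. Lie superalgebras $\mathfrak a=\mathfrak a_{\bar 0}\oplus\mathfrak a_{\bar 1}$ are finite-dimensional over $\mathbb K$; $[u,[u,u]]=0$ for odd $u$ is part of the definition (needed if $p=3$). $|u|$ is the parity of $u$; formulas with parities are for homogeneous elements. $\mathfrak z(\mathfrak a)$ is the center. A $p$-structure on a Lie algebra $L$ is a map $a\mapsto a^{[p]}$ with $\mathrm{ad}_{a^{[p]}}=(\mathrm{ad}_a)^p$, $(\alpha a)^{[p]}=\alpha^pa^{[p]}$, $(a+b)^{[p]}=a^{[p]}+b^{[p]}+\sum_{i=1}^{p-1}s_i(a,b)$, where $(\mathrm{ad}_{\mu a+b})^{p-1}(a)=\sum_{i=1}^{p-1}i\,s_i(a,b)\mu^{i-1}$. A $p|2p$-map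 on $\mathfrak a$ is a $p$-structure on $\mathfrak a_{\bar 0}$ with $\mathrm{ad}_{a^{[p]}}(b)=(\mathrm{ad}_a)^p(b)$ for all $a\in\mathfrak a_{\bar 0}$, $b\in\mathfrak a$. $\mathfrak a$ with a $p|2p$-map is called restricted. A homogeneous ideal $I$ is a $p$-ideal if $a^{[p]}\in I_{\bar 0}$ for all $a\in I_{\bar 0}$. A bilinear form $\omega$ is (super) anti-symmetric if $\omega(a,b)=-(-1)^{|a||b|}\omega(b,a)$, and closed if $(-1)^{|a||c|}\omega(a,[b,c])+(-1)^{|c||b|}\omega(c,[a,b])+(-1)^{|b||a|}\omega(b,[c,a])=0$. $(\mathfrak a,\omega)$ is quasi-Frobenius if $\omega$ is a non-degenerate closed anti-symmetric form; orthosymplectic if $\omega$ is even ($\omega(\mathfrak a_{\bar 0},\mathfrak a_{\bar 1})=\omega(\mathfrak a_{\bar 1},\mathfrak a_{\bar 0})=0$). $S^\perp=\{v:\omega(v,w)=0\ \forall w\in S\}$. The adjoint $\mathscr D^*$ of a derivation $\mathscr D$ is defined by $\omega(\mathscr D(a),b)=(-1)^{|a||\mathscr D|}\omega(a,\mathscr D^*(b))$. $\mathscr D$ is restricted if $\mathscr D(a^{[p]})=(\mathrm{ad}_a)^{p-1}(\mathscr D(a))$ for all $a\in\mathfrak a_{\bar 0}$. Restricted cochains with trivial coefficients: for an anti-symmetric bilinear $\alpha:\mathfrak a\times\mathfrak a\to\mathbb K$, a map $\beta:\mathfrak a_{\bar 0}\to\mathbb K$ has the $*$-property with respect to $\alpha$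 if $\beta(\delta a)=\delta^p\beta(a)$ and $\beta(a+b)=\beta(a)+\beta(b)+\sum\frac1{\pi\{a\}}\alpha([[\dots[x_1,x_2],x_3]\dots,x_{p-1}],x_p)$, the sum over all choices $x_i\in\{a,b\}$ with $x_1=a$, $x_2=b$, $\pi\{a\}$ being the number of $x_i$ equal to $a$. $C^2_*(\mathfrak a;\mathbb K)$ is the set of such pairs $(\alpha,\beta)$. $Z^2_*(\mathfrak a;\mathbb K)$ consists of those with $\alpha$ closed and $\alpha(a,b^{[p]})-\alpha([[\dots[a,b],\dots],b],b)=0$ for $a,b\in\mathfrak a_{\bar 0}$ (with $p-1$ brackets by $b$ in the first entry). $B^2_*(\mathfrak a;\mathbb K)$ consists of those for which there is a linear $\varphi:\mathfrak a\to\mathbb K$ with $\alpha(a,b)=\varphi([a,b])$, $\beta(a)=\varphi(a^{[p]})$. Symplectic $\mathscr D_{\bar 0}$-extension (orthosymplectic case). Data: a restricted orthosymplectic quasi-Frobenius $(\mathfrak a,\omega_{\mathfrak a})$; an even restricted derivation $\mathscr D$ of $\mathfrak a$ with $\gamma\in\mathbb K$, $a_0\in\mathfrak a_{\bar 0}$ such that $\mathscr D^p=\gamma\mathscr D+\mathrm{ad}_{a_0}$, $\mathscr D(a_0)=0$; $\lambda\in\mathbb K$; a map $P:\mathfrak a_{\bar 0}\to\mathbb K$ with $P(\delta a)=\delta^pP(a)$, $P(a+b)=P(a)+P(b)+\sum_{i=1}^{p-1}\sigma_i^{\mathfrak a}(a,b)$, where $\omega_{\mathfrak a}((\mathscr D+\mathscr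 D^* )(\mu a+b),(\mathrm{ad}_{\mu a+b})^{p-2}(a))=\sum_i i\,\sigma_i^{\mathfrak a}(a,b)\mu^{i-1}$; such that $(C,P)\in Z^2_*(\mathfrak a;\mathbb K)$ with $C(a,b)=\omega_{\mathfrak a}((\mathscr D+\mathscr D^* )(a),b)$, and $(\Omega,T)\in B^2_*(\mathfrak a;\mathbb K)$ with $\Omega(a,b)=\omega_{\mathfrak a}((\mathscr D^2+2\mathscr D^*\mathscr D+(\mathscr D^* )^2+\lambda(\mathscr D+\mathscr D^* ))(a),b)$, $T(a)=\omega_{\mathfrak a}((\mathscr D+\mathscr D^* )(a),(\mathrm{ad}_a)^{p-2}\mathscr D(a))+\lambda P(a)$; and $Z_\Omega\in\mathfrak a_{\bar 0}$ with $\Omega(a,b)=\omega_{\mathfrak a}(Z_\Omega,[a,b])$, $T(a)=\omega_{\mathfrak a}(Z_\Omega,a^{[p]})$. The extension is $\mathfrak g=\mathbb Kx\oplus\mathfrak a\oplus\mathbb Kx^*$ with $x,x^*$ even, bracket $[x,x^*]=\lambda x$, $[x,a]=0$, $[a,b]_{\mathfrak g}=[a,b]_{\mathfrak a}+C(a,b)x$, $[x^*,a]=\mathscr D(a)+\omega_{\mathfrak a}(Z_\Omega,a)x$; form $\omega_{\mathfrak g}|_{\mathfrak a\times\mathfrak a}=\omega_{\mathfrak a}$, $\omega_{\mathfrak g}(x^*,x)=1$, $\mathfrak a\perp x,x^*$, $\omega_{\mathfrak g}(x,x)=\omega_{\mathfrak g}(x^*,x^* )=0$; and $p|2p$-map $a^{[p]_{\mathfrak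 g}}=a^{[p]_{\mathfrak a}}+P(a)x$, $(x^* )^{[p]_{\mathfrak g}}=\gamma x^*+a_0+\tilde\lambda x$, $x^{[p]_{\mathfrak g}}=b_0+\sigma x+\delta x^*$ with $b_0\in\mathfrak a_{\bar 0}$, $\tilde\lambda,\sigma,\delta\in\mathbb K$ satisfying one of: (a) $\lambda\ne0$, $\tilde\lambda=\lambda^{-1}\omega_{\mathfrak a}(Z_\Omega,a_0)$, $\gamma=\lambda^{p-1}$, $\delta=0$, $\mathscr D(b_0)=\mathscr D^*(b_0)=0$, $\sigma=\lambda^{-1}\omega_{\mathfrak a}(Z_\Omega,b_0)$, $b_0\in\mathfrak z(\mathfrak a)$, $\mathscr D^*(a_0)=\sum_{i=1}^{p-1}(-\lambda)^{p-1-i}(\mathscr D^* )^i(Z_\Omega)$; (b) $\lambda=0$, $\delta=0$, $\omega_{\mathfrak a}(Z_\Omega,a_0)=\omega_{\mathfrak a}(Z_\Omega,b_0)=0$, $\mathscr D(b_0)=\mathscr D^*(b_0)=0$, $b_0\in\mathfrak z(\mathfrak a)$, $\mathscr D^*(a_0)+\gamma Z_\Omega=(\mathscr D^* )^{p-1}(Z_\Omega)$; (c) $\lambda=0$, $\delta\ne0$, $\mathscr D=-\delta^{-1}\mathrm{ad}_{b_0}$, $\omega_{\mathfrak a}(Z_\Omega,a_0)=\omega_{\mathfrak a}(Z_\Omega,b_0)=0$, $\mathscr D(b_0)=0$, $\mathscr D^*(b_0)=-\delta Z_\Omega$, $\mathscr D^*(a_0)+\gamma Z_\Omega=(\mathscr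 D^* )^{p-1}(Z_\Omega)$. ''Obtained as'' means equal to such an extension up to an isomorphism of restricted Lie superalgebras preserving the forms, $x$ corresponding to the given element. The double extension is classical if $x$ is central, i.e. $\lambda=0$.
   Formalization: The ''Moreover'' fails as stated: a suitable central x need not exist. Proved instead: each nonzero x in the even center lies in [g,g]^⊥, K and K^⊥ are ideals, and if K^⊥ is a p-ideal, then g is a classical extension with this x. *)

(* Defs.v *)
From HB Require Import structures.
From mathcomp Require Import all_boot all_order all_algebra.

Set Implicit Arguments.
Unset Strict Implicit.
Unset Printing Implicit Defensive.

Import GRing.Theory.
Local Open Scope ring_scope.

(** * Lie superalgebras *)

(* Raw Z/2-graded algebra: [part g false] is the even part and [part g true]
   the odd part, so that addition of parities is [(+)] and the sign
   (-1)^{|a||b|} is [(-1) ^+ (i && j)]. *)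
Structure superAlgebra (K : fieldType) := SuperAlgebra {
  superAlgebra_sort :> vectType K;
  part : bool -> {vspace superAlgebra_sort};
  br : superAlgebra_sort -> superAlgebra_sort -> superAlgebra_sort
}.

Arguments part {K} g i : rename.
Arguments br {K g} a b : rename.

Definition is_bilinear (K : fieldType) (U V W : lmodType K)
    (f : U -> V -> W) : Prop :=
  (forall u, linear (f u)) /\ (forall v, linear (f^~ v)).

Record lie_superalgebra (K : fieldType) (g : superAlgebra K) : Prop := {
  part_add : (part g false + part g true)%VS = fullv;
  part_cap : (part g false :&: part g true)%VS = 0%VS;
  br_bilinear : is_bilinear (@br K g);
  br_part : forall i j (a b : g), a \in part g i -> b \in part g j ->
    br a b \in part g (i (+) j);
  br_antisym : forall i j (a b : g), a \in part g i -> b \in part g j ->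
    br a b = - ((-1) ^+ (i && j) *: br b a);
  br_jacobi : forall i j k (a b c : g),
    a \in part g i -> b \in part g j -> c \in part g k ->
    br a (br b c) = br (br a b) c + (-1) ^+ (i && j) *: br b (br a c);
  br_cube : forall u : g, u \in part g true -> br u (br u u) = 0
}.

(* By bilinearity, the brackets of basis vectors span all brackets. *)
Definition derived_algebra (K : fieldType) (g : superAlgebra K) : {vspace g} :=
  <<[seq br a b | a <- vbasis {: g}, b <- vbasis {: g}]>>%VS.

Definition in_center (K : fieldType) (g : superAlgebra K) (a : g) : Prop :=
  forall b : g, br a b = 0.

Definition homogeneous_ideal (K : fieldType) (g : superAlgebra K)
    (I : g -> Prop) : Prop :=
  [/\ I 0,
      forall (k : K) (a b : g), I a -> I b -> I (k *: a + b),
      forall a, I a -> exists a0 a1 : g,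
        [/\ a0 \in part g false, a1 \in part g true, a = a0 + a1, I a0 & I a1]
    & forall a b : g, I b -> I (br a b)].

(** * Restricted structures *)

(* [F mu] is polynomial in [mu], of degree at most p - 2: since K has at least
   p elements, the coefficients [s i], 0 < i < p, are determined by [F]. *)
Definition jacobson_coefs (K : fieldType) (V : lmodType K) (p : nat)
    (F : K -> V) (s : nat -> V) : Prop :=
  forall mu : K, F mu = \sum_(1 <= i < p) (i%:R * mu ^+ i.-1) *: s i.

(* The maps [pm] below are total functions on the carrier, but only their
   values on the even part matter; the same holds for the maps [beta] and [P]
   further down. *)
Record p_structure (K : fieldType) (p : nat) (g : superAlgebra K)
    (pm : g -> g) : Prop := {
  pm_even : forall a : g, a \in part g false -> pm a \in part g false;
  pm_ad : forall a b : g, a \in part g false -> b \in part g false ->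
    br (pm a) b = iter p (br a) b;
  pm_scale : forall (k : K) (a : g), a \in part g false ->
    pm (k *: a) = k ^+ p *: pm a;
  pm_add : forall a b : g, a \in part g false -> b \in part g false ->
    exists s : nat -> g,
      jacobson_coefs p (fun mu => iter p.-1 (br (mu *: a + b)) a) s /\
      pm (a + b) = pm a + pm b + \sum_(1 <= i < p) s i
}.

Definition p2p_map (K : fieldType) (p : nat) (g : superAlgebra K)
    (pm : g -> g) : Prop :=
  p_structure p pm /\
  forall a b : g, a \in part g false -> br (pm a) b = iter p (br a) b.

Definition p_ideal (K : fieldType) (g : superAlgebra K) (pm : g -> g)
    (I : g -> Prop) : Prop :=
  homogeneous_ideal I /\ forall a : g, a \in part g false -> I a -> I (pm a).

(** * Forms *)

Definition super_antisymmetric (K : fieldType) (g : superAlgebra K)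
    (w : g -> g -> K) : Prop :=
  forall i j (a b : g), a \in part g i -> b \in part g j ->
    w a b = - ((-1) ^+ (i && j) * w b a).

Definition closed_form (K : fieldType) (g : superAlgebra K)
    (w : g -> g -> K) : Prop :=
  forall i j k (a b c : g),
    a \in part g i -> b \in part g j -> c \in part g k ->
    (-1) ^+ (i && k) * w a (br b c) + (-1) ^+ (k && j) * w c (br a b)
      + (-1) ^+ (j && i) * w b (br c a) = 0.

Definition nondegenerate (K : fieldType) (g : superAlgebra K)
    (w : g -> g -> K) : Prop :=
  forall a : g, (forall b : g, w a b = 0) -> a = 0.

Definition even_form (K : fieldType) (g : superAlgebra K)
    (w : g -> g -> K) : Prop :=
  forall a b : g, a \in part g false -> b \in part g true ->
    w a b = 0 /\ w b a = 0.

Record quasi_frobenius (K : fieldType) (g : superAlgebra K)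
    (w : g -> g -> K) : Prop := {
  qf_bilinear : is_bilinear (w : g -> g -> K^o);
  qf_antisym : super_antisymmetric w;
  qf_closed : closed_form w;
  qf_nondegenerate : nondegenerate w
}.

Record restricted_orthosymplectic_qf (K : fieldType) (p : nat)
    (g : superAlgebra K) (pm : g -> g) (w : g -> g -> K) : Prop := {
  roqf_lie : lie_superalgebra g;
  roqf_pm : p2p_map p pm;
  roqf_qf : quasi_frobenius w;
  roqf_even : even_form w
}.

Definition orthogonal_to (K : fieldType) (g : superAlgebra K)
    (w : g -> g -> K) (S : {vspace g}) (v : g) : Prop :=
  forall u : g, u \in S -> w v u = 0.

(** * Derivations *)

(* [d] is the parity of [D]. *)
Definition derivation (K : fieldType) (g : superAlgebra K) (d : bool)
    (D : 'End(g)) : Prop :=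
  (forall i (a : g), a \in part g i -> D a \in part g (i (+) d)) /\
  forall i (a b : g), a \in part g i ->
    D (br a b) = br (D a) b + (-1) ^+ (d && i) *: br a (D b).

Definition restricted_derivation (K : fieldType) (p : nat)
    (g : superAlgebra K) (pm : g -> g) (d : bool) (D : 'End(g)) : Prop :=
  derivation d D /\
  forall a : g, a \in part g false -> D (pm a) = iter p.-1 (br a) (D a).

(* For a non-degenerate form, [Ds] is determined by [D]. *)
Definition adjoint_of (K : fieldType) (g : superAlgebra K)
    (w : g -> g -> K) (d : bool) (D Ds : 'End(g)) : Prop :=
  forall i (a b : g), a \in part g i ->
    w (D a) b = (-1) ^+ (i && d) * w a (Ds b).

(** * Restricted cochains with trivial coefficients *)

Definition left_normed (K : fieldType) (g : superAlgebra K) (s : seq g) : g :=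
  if s is x :: s' then foldl br x s' else 0.

(* A choice of x_1, ..., x_p in {a, b} is a tuple of booleans, where [true]
   stands for a and [false] for b. *)
Definition star_property (K : fieldType) (p : nat) (g : superAlgebra K)
    (alpha : g -> g -> K) (beta : g -> K) : Prop :=
  (forall (k : K) (a : g), a \in part g false -> beta (k *: a) = k ^+ p * beta a)
  /\
  forall a b : g, a \in part g false -> b \in part g false ->
    let x (e : bool) := if e then a else b in
    beta (a + b) = beta a + beta b +
      \sum_(t : p.-tuple bool | nth false t 0 && ~~ nth true t 1)
        (count id t)%:R^-1 *
        alpha (left_normed (map x (take p.-1 t))) (x (nth false t p.-1)).

Definition cochain2 (K : fieldType) (p : nat) (g : superAlgebra K)
    (alpha : g -> g -> K) (beta : g -> K) : Prop :=
  [/\ is_bilinear (alpha : g -> g -> K^o), super_antisymmetric alpha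
    & star_property p alpha beta].

Definition cocycle2 (K : fieldType) (p : nat) (g : superAlgebra K)
    (pm : g -> g) (alpha : g -> g -> K) (beta : g -> K) : Prop :=
  [/\ cochain2 p alpha beta, closed_form alpha
    & forall a b : g, a \in part g false -> b \in part g false ->
        alpha a (pm b) - alpha (iter p.-1 (br^~ b) a) b = 0].

Definition coboundary2 (K : fieldType) (p : nat) (g : superAlgebra K)
    (pm : g -> g) (alpha : g -> g -> K) (beta : g -> K) : Prop :=
  cochain2 p alpha beta /\
  exists phi : 'Hom(g, K^o),
    (forall a b : g, alpha a b = phi (br a b)) /\
    (forall a : g, a \in part g false -> beta a = phi (pm a)).

(** * Symplectic extensions by an even derivation *)

Record extData (K : fieldType) (a : superAlgebra K) := ExtData {
  eD : 'End(a);
  eDs : 'End(a);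
  egamma : K;
  ea0 : a;
  elambda : K;
  eP : a -> K;
  eZ : a;
  eb0 : a;
  eltilde : K;
  esigma : K;
  edelta : K
}.

Definition eC (K : fieldType) (a : superAlgebra K) (w : a -> a -> K)
    (e : extData a) (u v : a) : K :=
  w (eD e u + eDs e u) v.

Definition eOmega (K : fieldType) (a : superAlgebra K) (w : a -> a -> K)
    (e : extData a) (u v : a) : K :=
  w (eD e (eD e u) + 2%:R *: eDs e (eD e u) + eDs e (eDs e u)
     + elambda e *: (eD e u + eDs e u)) v.

Definition eT (K : fieldType) (p : nat) (a : superAlgebra K)
    (w : a -> a -> K) (e : extData a) (u : a) : K :=
  w (eD e u + eDs e u) (iter p.-2 (br u) (eD e u)) + elambda e * eP e u.

Record ext_data_ok (K : fieldType) (p : nat) (a : superAlgebra K)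
    (pm : a -> a) (w : a -> a -> K) (e : extData a) : Prop := {
  eD_restricted : restricted_derivation p pm false (eD e);
  eDs_adjoint : adjoint_of w false (eD e) (eDs e);
  ea0_even : ea0 e \in part a false;
  eD_iter : forall u : a,
    iter p (eD e) u = egamma e *: eD e u + br (ea0 e) u;
  eD_a0 : eD e (ea0 e) = 0;
  eP_scale : forall (k : K) (u : a), u \in part a false ->
    eP e (k *: u) = k ^+ p * eP e u;
  eP_add : forall u v : a, u \in part a false -> v \in part a false ->
    exists s : nat -> K,
      jacobson_coefs (V := K^o) p
        (fun mu => w (eD e (mu *: u + v) + eDs e (mu *: u + v))
                     (iter p.-2 (br (mu *: u + v)) u)) s /\
      eP e (u + v) = eP e u + eP e v + \sum_(1 <= i < p) s i;
  eCP_cocycle : cocycle2 p pm (eC w e) (eP e);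
  eOmegaT_coboundary : coboundary2 p pm (eOmega w e) (eT p w e);
  eZ_even : eZ e \in part a false;
  eZ_Omega : forall u v : a, eOmega w e u v = w (eZ e) (br u v);
  eZ_T : forall u : a, u \in part a false -> eT p w e u = w (eZ e) (pm u);
  eb0_even : eb0 e \in part a false
}.

Definition ext_case_a (K : fieldType) (p : nat) (a : superAlgebra K)
    (w : a -> a -> K) (e : extData a) : Prop :=
  [/\ elambda e != 0,
      eltilde e = (elambda e)^-1 * w (eZ e) (ea0 e),
      egamma e = elambda e ^+ p.-1
    & edelta e = 0] /\
  [/\ eD e (eb0 e) = 0 /\ eDs e (eb0 e) = 0,
      esigma e = (elambda e)^-1 * w (eZ e) (eb0 e),
      in_center (eb0 e)
    & eDs e (ea0 e) =
        \sum_(1 <= i < p) (- elambda e) ^+ (p - 1 - i) *: iter i (eDs e) (eZ e)].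

Definition ext_case_b (K : fieldType) (p : nat) (a : superAlgebra K)
    (w : a -> a -> K) (e : extData a) : Prop :=
  [/\ elambda e = 0,
      edelta e = 0
    & w (eZ e) (ea0 e) = 0 /\ w (eZ e) (eb0 e) = 0] /\
  [/\ eD e (eb0 e) = 0 /\ eDs e (eb0 e) = 0,
      in_center (eb0 e)
    & eDs e (ea0 e) + egamma e *: eZ e = iter p.-1 (eDs e) (eZ e)].

Definition ext_case_c (K : fieldType) (p : nat) (a : superAlgebra K)
    (w : a -> a -> K) (e : extData a) : Prop :=
  [/\ elambda e = 0,
      edelta e != 0,
      forall u : a, eD e u = - (edelta e)^-1 *: br (eb0 e) u
    & w (eZ e) (ea0 e) = 0 /\ w (eZ e) (eb0 e) = 0] /\
  [/\ eD e (eb0 e) = 0,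
      eDs e (eb0 e) = - edelta e *: eZ e
    & eDs e (ea0 e) + egamma e *: eZ e = iter p.-1 (eDs e) (eZ e)].

(* The triple (c, u, d) stands for c x + u + d x^*. *)
Definition extSpace (K : fieldType) (a : superAlgebra K) : vectType K :=
  (K^o * a * K^o)%type.

Definition ext_proj (K : fieldType) (a : superAlgebra K) (t : extSpace a) : a :=
  t.1.2.

Lemma ext_proj_linear (K : fieldType) (a : superAlgebra K) :
  linear (@ext_proj K a).
Proof. by []. Qed.

HB.instance Definition _ (K : fieldType) (a : superAlgebra K) :=
  GRing.isLinear.Build K (extSpace a) a *:%R (@ext_proj K a)
    (@ext_proj_linear K a).

Definition ext_inj (K : fieldType) (a : superAlgebra K) (u : a) : extSpace a :=
  (0, u, 0).

Lemma ext_inj_linear (K : fieldType) (a : superAlgebra K) :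
  linear (@ext_inj K a).
Proof.
by move=> k u v; congr (_, _, _); rewrite /= ?scaler0 ?addr0.
Qed.

HB.instance Definition _ (K : fieldType) (a : superAlgebra K) :=
  GRing.isLinear.Build K a (extSpace a) *:%R (@ext_inj K a)
    (@ext_inj_linear K a).

Definition ext_part (K : fieldType) (a : superAlgebra K) (i : bool) :
    {vspace extSpace a} :=
  if i then (linfun (@ext_inj K a) @: part a true)%VS
  else (linfun (@ext_proj K a) @^-1: part a false)%VS.

Lemma mem_ext_part0 (K : fieldType) (a : superAlgebra K) (t : extSpace a) :
  (t \in ext_part a false) = (t.1.2 \in part a false).
Proof. by rewrite /ext_part -memv_preim lfunE. Qed.

Lemma mem_ext_part1 (K : fieldType) (a : superAlgebra K) (t : extSpace a) :
  (t \in ext_part a true)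
    = [&& t.1.1 == 0, t.1.2 \in part a true & t.2 == 0].
Proof.
apply/memv_imgP/and3P => [[u uP ->]|]; first by rewrite lfunE /= !eqxx.
case: t => [[c u] d] /= [/eqP -> uP /eqP ->].
by exists u; rewrite ?lfunE.
Qed.

Definition ext_br (K : fieldType) (a : superAlgebra K) (w : a -> a -> K)
    (e : extData a) (t t' : extSpace a) : extSpace a :=
  let: (c, u, d) := t in
  let: (c', u', d') := t' in
  (elambda e * (c * d' - d * c') + eC w e u u'
     + d * w (eZ e) u' - d' * w (eZ e) u,
   br u u' + d *: eD e u' - d' *: eD e u,
   0).

Definition extAlgebra (K : fieldType) (a : superAlgebra K) (w : a -> a -> K)
    (e : extData a) : superAlgebra K :=
  SuperAlgebra (@ext_part K a) (ext_br w e).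

Definition ext_form (K : fieldType) (a : superAlgebra K) (w : a -> a -> K)
    (t t' : extSpace a) : K :=
  w t.1.2 t'.1.2 + t.2 * t'.1.1 - t.1.1 * t'.2.

(* These values and [p2p_map] determine the p|2p-map on the even part. *)
Definition ext_pm_values (K : fieldType) (a : superAlgebra K) (pm : a -> a)
    (e : extData a) (pme : extSpace a -> extSpace a) : Prop :=
  [/\ forall u : a, u \in part a false -> pme (0, u, 0) = (eP e u, pm u, 0),
      pme (0, 0, 1) = (eltilde e, ea0 e, egamma e)
    & pme (1, 0, 0) = (esigma e, eb0 e, edelta e)].

Record restricted_isometry (K : fieldType) (g h : superAlgebra K)
    (pmg : g -> g) (wg : g -> g -> K) (pmh : h -> h) (wh : h -> h -> K)
    (f : 'Hom(g, h)) : Prop := {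
  iso_bij : bijective f;
  iso_part : forall i (u : g), u \in part g i -> f u \in part h i;
  iso_br : forall u v : g, f (br u v) = br (f u) (f v);
  iso_pm : forall u : g, u \in part g false -> f (pmg u) = pmh (f u);
  iso_form : forall u v : g, wh (f u) (f v) = wg u v
}.

(* (g, wg) is the symplectic extension of (a, wa) defined by the data [e], the
   given element [x] of g corresponding to the generator x of the extension. *)
Definition obtained_as_extension (K : fieldType) (p : nat)
    (g : superAlgebra K) (pmg : g -> g) (wg : g -> g -> K) (x : g)
    (a : superAlgebra K) (pma : a -> a) (wa : a -> a -> K)
    (e : extData a) : Prop :=
  [/\ restricted_orthosymplectic_qf p pma wa,
      ext_data_ok p pma wa e,
      [\/ ext_case_a p wa e, ext_case_b p wa e | ext_case_c p wa e]
    & exists pme : extAlgebra wa e -> extAlgebra wa e,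
        [/\ p2p_map p pme, ext_pm_values pma e pme
          & exists f : 'Hom(g, extAlgebra wa e),
              restricted_isometry pmg wg pme (ext_form wa) f /\ f x = (1, 0, 0)]].

(* Main.v *)
From HB Require Import structures.
Require Import Defs.
From mathcomp Require Import all_boot all_order all_algebra.
From mathcomp Require Import ring.
Import GRing.Theory.
Local Open Scope ring_scope.

Set Implicit Arguments.
Unset Strict Implicit.
Unset Printing Implicit Defensive.

(** Since [x] spans an ideal orthogonal to [g,g], closedness of the form makes
    [x] commute with its own orthogonal. Choose an even [xs] (the x^* of the
    statement) with w(xs, x) = 1 and let [a] be the orthogonal of
    Span{x, xs}; then g = Kx + a + K xs and [g,g] lies in Kx + a. Bracket,
    p-map and form of [a] are those of g followed by the projection to [a], and
    the data of the extension are the components of [u,v], [xs,u], u^[p],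
    xs^[p] and x^[p]. Every condition required of them is the [a]- or the
    x-component of an identity of g: Jacobi, Jacobson's formula,
    ad(u^[p]) = ad(u)^p for u in [a], u = xs and u = x, and
    [xs, xs^[p]] = 0. *)

(** Projecting to [a] loses nothing because x commutes with [a]: the term C(u,v) x of a bracket dies
    in the next bracket, so only the outermost bracket of an iterated one contributes an
    x-component. Identities of g thus split cleanly into an identity of [a] and one between scalars.
    The p-ideal hypothesis does the same for p-th powers: it keeps xs out of u^[p]. The obstacle is
    the *-property. In g, additivity of P and T comes through the coefficients s_i of a polynomial
    in mu, while cochains ask for a sum over words in two letters. Comparing coefficients is
    legitimate even over a finite field, the degree being at most p - 2. For central x, centrality
    makes Kx an ideal and closedness puts x orthogonal to [g,g], so that the orthogonal of x is an
    ideal; its stability under the p-map remains an assumption. *)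

Section Bilinear.
Variables (K : fieldType) (U V W : lmodType K) (f : U -> V -> W).
Hypothesis fB : is_bilinear f.

Lemma bilDl u u' v : f (u + u') v = f u v + f u' v.
Proof. by have := fB.2 v 1 u u'; rewrite !scale1r. Qed.

Lemma bilDr u v v' : f u (v + v') = f u v + f u v'.
Proof. by have := fB.1 u 1 v v'; rewrite !scale1r. Qed.

Lemma bil0l v : f 0 v = 0.
Proof. by apply: (addrI (f 0 v)); rewrite -bilDl !addr0. Qed.

Lemma bil0r u : f u 0 = 0.
Proof. by apply: (addrI (f u 0)); rewrite -bilDr !addr0. Qed.

Lemma bilZl k u v : f (k *: u) v = k *: f u v.
Proof. by have := fB.2 v k u 0; rewrite !addr0 bil0l addr0. Qed.

Lemma bilZr k u v : f u (k *: v) = k *: f u v.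
Proof. by have := fB.1 u k v 0; rewrite !addr0 bil0r addr0. Qed.

Lemma bilNl u v : f (- u) v = - f u v.
Proof. by rewrite -!scaleN1r bilZl. Qed.

Lemma bilNr u v : f u (- v) = - f u v.
Proof. by rewrite -!scaleN1r bilZr. Qed.

Definition bilE := (bilDl, bilDr, bilNl, bilNr, bilZl, bilZr, bil0l, bil0r).

End Bilinear.

Section Linfun.
Variables (K : fieldType) (U V : vectType K).

(** [lfunE] expects a canonical linear structure; forms and brackets are linear only by hypothesis,
    so the structure is packed here. *)
Lemma linear_linfunE (f : U -> V) : linear f -> linfun f =1 f.
Proof.
move=> fL; pose h : {linear U -> V} :=
  HB.pack f (GRing.isLinear.Build K U V *:%R f fL).
exact: (lfunE h).
Qed.

End Linfun.

(** * Duality for a non-degenerate form *)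

Section Form.
Variables (K : fieldType) (V : vectType K) (w : V -> V -> K).
Hypothesis wB : is_bilinear (w : V -> V -> K^o).

Lemma bilfZl k u v : w (k *: u) v = k * w u v.
Proof. exact: (bilZl wB). Qed.

Lemma bilfZr k u v : w u (k *: v) = k * w u v.
Proof. exact: (bilZr wB). Qed.

Lemma bilfDl u u' v : w (u + u') v = w u v + w u' v.
Proof. exact: (bilDl wB). Qed.

Lemma bilfDr u v v' : w u (v + v') = w u v + w u v'.
Proof. exact: (bilDr wB). Qed.

Lemma bilfNl u v : w (- u) v = - w u v.
Proof. exact: (bilNl wB). Qed.

Lemma bilfNr u v : w u (- v) = - w u v.
Proof. exact: (bilNr wB). Qed.

Lemma bilf0l v : w 0 v = 0.
Proof. exact: (bil0l wB). Qed.

Lemma bilf0r u : w u 0 = 0.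
Proof. exact: (bil0r wB). Qed.

Definition bilfE :=
  (bilfDl, bilfDr, bilfNl, bilfNr, bilfZl, bilfZr, bilf0l, bilf0r).

Hypothesis w_nondeg : forall u, (forall v, w u v = 0) -> u = 0.

Let form_lin (u : V) : 'Hom(V, K^o) := linfun (w u : V -> K^o).

Let form_linE u v : form_lin u v = w u v.
Proof. exact: linear_linfunE (wB.1 u) v. Qed.

Let form_linD : linear form_lin.
Proof.
move=> k u u'; apply/lfunP => v; rewrite add_lfunE scale_lfunE !form_linE.
by rewrite bilfDl bilfZl.
Qed.

Let dual_iso : 'Hom(V, 'Hom(V, K^o)) := linfun form_lin.

Let dual_isoE u : dual_iso u = form_lin u.
Proof. exact: linear_linfunE form_linD u. Qed.

(** Non-degeneracy makes u |-> w(u, _) injective, and V and its dual have the same dimension. *)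
Let dual_iso_inv : cancel (dual_iso^-1)%VF dual_iso.
Proof.
have ker0 : (lker dual_iso == 0)%VS.
  apply/lker0P => u u'; rewrite !dual_isoE => eq_uu'.
  apply/eqP; rewrite -subr_eq0; apply/eqP/w_nondeg => v.
  by rewrite bilfDl bilfNl -!form_linE eq_uu' subrr.
have img : limg dual_iso = fullv.
  apply/eqP; rewrite eqEdim subvf limg_dim_eq ?(eqP ker0) ?capv0 //.
  by rewrite !dimvf /dim /= muln1.
by move=> h; rewrite limg_lfunVK // img memvf.
Qed.

Lemma form_represents (f : 'Hom(V, K^o)) : exists z, forall v, w z v = f v.
Proof.
by exists ((dual_iso^-1)%VF f) => v; rewrite -form_linE -dual_isoE dual_iso_inv.
Qed.

Lemma form_adjoint (D : 'End(V)) :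
  exists Ds : 'End(V), forall u v, w (Ds u) v = w u (D v).
Proof.
pose s (u : V) := (dual_iso^-1)%VF (form_lin u \o D)%VF.
have sE u v : w (s u) v = w u (D v).
  by rewrite -form_linE -dual_isoE dual_iso_inv comp_lfunE form_linE.
exists (linfun s) => u v; rewrite linear_linfunE // => k u1 u2.
apply/eqP; rewrite -subr_eq0; apply/eqP/w_nondeg => v'.
by rewrite !bilfE !sE !bilfE subrr.
Qed.

End Form.

(** * From homogeneous to arbitrary elements *)

Section Graded.
Variables (K : fieldType) (g : superAlgebra K).
Hypothesis gL : lie_superalgebra g.

Lemma part_decomp (v : g) :
  exists v0 v1, [/\ v0 \in part g false, v1 \in part g true & v = v0 + v1].
Proof.
have: v \in (part g false + part g true)%VS by rewrite (part_add gL) memvf.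
by case/memv_addP => v0 ? [v1 ? ->]; exists v0, v1.
Qed.

Lemma part_ind (Q : g -> Prop) :
  (forall u v, Q u -> Q v -> Q (u + v)) ->
  (forall i u, u \in part g i -> Q u) -> forall u, Q u.
Proof.
by move=> QD Qi u; have [u0 [u1 [u0P u1P ->]]] := part_decomp u; apply: QD;
  [apply: (Qi false) | apply: (Qi true)].
Qed.

Lemma part_disjoint (v : g) i : v \in part g i -> v \in part g (~~ i) -> v = 0.
Proof.
move=> vi vni; apply/eqP; rewrite -memv0 -(part_cap gL) memv_cap.
by case: i vi vni => /= -> ->.
Qed.

(** When one argument is even the sign is trivial whatever the parity of the other, so the law
    extends by additivity to inhomogeneous [b]. *)
Lemma even_br_antisym (a b : g) : a \in part g false -> br a b = - br b a.
Proof.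
move=> a0; have brB := br_bilinear gL; elim/part_ind: b => [u v Hu Hv|i u ui].
  by rewrite !(bilE brB) Hu Hv opprD.
by rewrite (br_antisym gL a0 ui) scale1r.
Qed.

Lemma even_br_jacobi (a b c : g) : a \in part g false ->
  br a (br b c) = br (br a b) c + br b (br a c).
Proof.
move=> a0; have brB := br_bilinear gL.
elim/part_ind: b c => [u v Hu Hv|i b bi] c.
  by rewrite !(bilE brB) Hu Hv addrACA.
elim/part_ind: c => [u v Hu Hv|j c cj].
  by rewrite !(bilE brB) Hu Hv addrACA.
by rewrite (br_jacobi gL a0 bi cj) scale1r.
Qed.

Lemma even_br_self (a : g) : 2 \notin [pchar K] ->
  a \in part g false -> br a a = 0.
Proof.
move=> char2 a0; apply/eqP; have /eqP := even_br_antisym a a0.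
rewrite -addr_eq0 -mulr2n -scaler_nat scaler_eq0.
by move: char2; rewrite inE /= => /negbTE ->.
Qed.

End Graded.

Section GradedForm.
Variables (K : fieldType) (g : superAlgebra K) (w : g -> g -> K).
Hypothesis gL : lie_superalgebra g.
Hypothesis wB : is_bilinear (w : g -> g -> K^o).

Lemma even_form_antisym (a : g) : super_antisymmetric w ->
  a \in part g false -> forall b, w a b = - w b a.
Proof.
move=> wA a0 b; elim/(part_ind gL): b => [u v Hu Hv|i u ui].
  by rewrite !(bilfE wB) Hu Hv opprD.
by rewrite (wA _ _ _ _ a0 ui) mul1r.
Qed.

Lemma even_form_neq i (a b : g) : even_form w ->
  a \in part g i -> b \in part g (~~ i) -> w a b = 0.
Proof. by move=> wE; case: i => ai bi; [case: (wE b a) | case: (wE a b)]. Qed.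

Lemma form_ext_part (w' : g -> g -> K) :
  is_bilinear (w' : g -> g -> K^o) ->
  (forall i j (u v : g), u \in part g i -> v \in part g j -> w u v = w' u v) ->
  forall u v, w u v = w' u v.
Proof.
move=> w'B ww' u v; elim/(part_ind gL): u => [u u' Hu Hu'|i u ui].
  by rewrite (bilfDl wB) Hu Hu' (bilfDl w'B).
elim/(part_ind gL): v => [v v' Hv Hv'|j v vj].
  by rewrite (bilfDr wB) Hv Hv' (bilfDr w'B).
exact: ww' ui vj.
Qed.

(** The component of z of the wrong parity is orthogonal to both parts: to one since w is even, to
    the other by assumption. This gives the parities of the adjoint and of Z_Omega. *)
Lemma represented_part i (z : g) : even_form w -> Defs.nondegenerate w ->
  (forall v, v \in part g (~~ i) -> w z v = 0) -> z \in part g i.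
Proof.
move=> wE wN zN; have [z0 [z1 [z0P z1P zE]]] := part_decomp gL z.
suff H (u u' : g) : u \in part g i -> u' \in part g (~~ i) -> z = u + u' ->
    z \in part g i.
  case: i {zN} H => H; last exact: (H z0 z1).
  by apply: (H z1 z0); rewrite // addrC.
move=> ui u'i zuu'; suff u'0 : u' = 0 by rewrite zuu' u'0 addr0.
apply: wN; elim/(part_ind gL) => [v v' Hv Hv'|j v vj].
  by rewrite (bilfDr wB) Hv Hv' addr0.
have [ji|ji] := eqVneq j i.
  by rewrite (even_form_neq wE u'i) ?negbK -?ji.
have vi : v \in part g (~~ i) by case: j i ji vj {zN ui u'i} => [] [].
by rewrite -(zN v vi) zuu' (bilfDl wB) (even_form_neq wE ui vi) add0r.
Qed.

End GradedForm.

(** * Polynomial functions in characteristic p *)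

Section CharP.
Variables (K : fieldType) (p : nat).
Hypothesis charKp : p \in [pchar K].

Lemma natr_neq0 i : (0 < i < p)%N -> i%:R != 0 :> K.
Proof.
case/andP => i0 ip; rewrite -(dvdn_pcharf charKp).
by apply/negP => /(dvdn_leq i0); rewrite leqNgt ip.
Qed.

Lemma uniq_natr : uniq [seq i%:R : K | i <- iota 0 p].
Proof.
rewrite map_inj_in_uniq ?iota_uniq // => i j.
rewrite !mem_iota /= add0n => ip jp.
wlog lt_ij : i j ip jp / (i < j)%N.
  by move=> H; case: (ltngtP i j) => // /H Hij eq_ij; [| symmetry]; apply: Hij.
move=> eq_ij; have /negP[] : (j - i)%:R != 0 :> K.
  by apply: natr_neq0; rewrite subn_gt0 lt_ij (leq_ltn_trans (leq_subr _ _)).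
by rewrite natrB ?(ltnW lt_ij) // eq_ij subrr.
Qed.

(** The polynomial has size at most p - 1 but vanishes at the p distinct images of 0, ..., p - 1. *)
Lemma poly_fun_eq0 (c : nat -> K) :
  (forall mu, \sum_(1 <= i < p) c i * mu ^+ i.-1 = 0) ->
  forall i, (0 < i < p)%N -> c i = 0.
Proof.
move=> c0 i /andP[i0 ip]; pose q := \poly_(j < p.-1) c j.+1.
have q0 : q = 0.
  apply/eqP; apply: contraT => /max_poly_roots/(_ _ uniq_natr) size_q.
  have: (size [seq (i%:R : K) | i <- iota 0 p] < size q)%N.
    apply: size_q; apply/allP => mu _.
    by rewrite /root horner_poly -[X in _ == X](c0 mu) big_add1 big_mkord.
  rewrite size_map size_iota ltnNge (leq_trans (size_poly _ _)) //.
  exact: leq_pred.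
have := congr1 (fun r : {poly K} => r`_i.-1) q0.
rewrite coef0 coef_poly prednK // ifT // -ltnS prednK //.
by case: p ip.
Qed.

End CharP.

(** * Words in two letters and the *-property *)

Lemma sum_tuple_cons {n} {V : nmodType} (F : seq bool -> V) :
  \sum_(t : n.+1.-tuple bool) F t =
    \sum_(e : bool) \sum_(t : n.-tuple bool) F (e :: t).
Proof.
rewrite pair_big /=.
rewrite (reindex (fun q : bool * n.-tuple bool => cons_tuple q.1 q.2)) //=.
exists (fun t : n.+1.-tuple bool => (thead t, [tuple of behead t])).
  by move=> [e t] _; congr (_, _); apply: val_inj.
by move=> t _; rewrite [RHS]tuple_eta; apply: val_inj.
Qed.

(** The condition fixes the first two letters. [F] takes plain sequences, so that it still applies
    once letters are peeled off. *)
Lemma sum_tuple_true_false {n} {V : nmodType} (F : seq bool -> V) :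
  \sum_(t : n.+2.-tuple bool | nth false t 0 && ~~ nth true t 1) F t =
    \sum_(t : n.-tuple bool) F [:: true, false & t].
Proof.
pose G s t := if nth false t 0 && ~~ nth s t 1 then F t else 0.
rewrite big_mkcond (sum_tuple_cons (G true)) big_bool /=.
rewrite (sum_tuple_cons (fun t => G true (true :: t))) big_bool /=.
by rewrite /G /= [X in X + _ + _]big1 // [X in _ + X]big1 // add0r addr0.
Qed.

Section StarProperty.
Variables (K : fieldType) (p : nat) (g : superAlgebra K).
Variables (alpha : g -> g -> K) (beta : g -> K).
Hypothesis gL : lie_superalgebra g.
Hypothesis alphaB : is_bilinear (alpha : g -> g -> K^o).

Let brB := br_bilinear gL.

Lemma foldl_brDl (s : seq g) k a b :
  foldl br (k *: a + b) s = k *: foldl br a s + foldl br b s.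
Proof.
by elim: s a b => //= y s IHs a b; rewrite !(bilE brB) IHs.
Qed.

Lemma foldl_br0 (s : seq g) : foldl br 0 s = 0.
Proof. by elim: s => //= y s; rewrite !(bilE brB). Qed.

(** Each of the n + 1 occurrences of mu u + v chooses a letter, and every choice of u brings a
    factor mu. The head [a] is generalised because [foldl] absorbs letters from the left. *)
Lemma left_normed_expansion (mu : K) (u v a : g) n :
  let x (e : bool) := if e then u else v in
  alpha (foldl br a (nseq n (mu *: u + v))) (mu *: u + v) =
    \sum_(t : n.+1.-tuple bool)
      mu ^+ count id t *
        alpha (foldl br a (map x (take n t))) (x (nth false t n)).
Proof.
move=> x; elim: n a => [|n IHn] a.
  rewrite (sum_tuple_cons (fun t => mu ^+ count id t *
    alpha (foldl br a (map x (take 0 t))) (x (nth false t 0)))).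
  rewrite big_bool /= !(bilfE alphaB).
  have sum_nil (F : 0.-tuple bool -> K) : \sum_t F t = F [tuple].
    by apply: big_pred1 => t; apply/esym/eqP; apply: tuple0.
  by rewrite !sum_nil expr1 expr0 mul1r.
rewrite (sum_tuple_cons (fun t => mu ^+ count id t *
    alpha (foldl br a (map x (take n.+1 t))) (x (nth false t n.+1)))).
rewrite big_bool /= !(bilE brB) foldl_brDl (bilfDl alphaB) (bilfZl alphaB) !IHn.
congr (_ + _).
  by rewrite big_distrr; apply: eq_bigr => t _; rewrite /= add1n exprS mulrA.
Qed.

(** Powers of ad nest to the right, cochain words to the left; turning each bracket around costs a
    sign. *)
Lemma iter_br_foldl (y a : g) n : y \in part g false ->
  iter n (br y) a = (-1) ^+ n *: foldl br a (nseq n y).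
Proof.
move=> y0; elim: n a => [|n IHn] a; first by rewrite scale1r.
rewrite iterSr IHn /= (even_br_antisym gL) // exprSr -scalerA scaleN1r.
rewrite -[- br a y]scaleN1r -[_ *: br a y]addr0 foldl_brDl foldl_br0 addr0.
by rewrite scaleN1r.
Qed.

Hypothesis charKp : p \in [pchar K].
Hypothesis p_gt2 : (2 < p)%N.
Hypothesis alphaA : super_antisymmetric alpha.

Lemma char_neq2 : 2 \notin [pchar K].
Proof.
by rewrite (pcharf_eq charKp) inE /= eq_sym gtn_eqF.
Qed.

Section Pair.
Variables u v : g.
Hypotheses (u0 : u \in part g false) (v0 : v \in part g false).

Let x (e : bool) := if e then u else v.
Let good (t : seq bool) := nth false t 0 && ~~ nth true t 1.
Let term (t : seq bool) :=
  alpha (left_normed (map x (take p.-1 t))) (x (nth false t p.-1)).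

Let alpha_expansion mu :
  alpha (mu *: u + v) (iter p.-2 (br (mu *: u + v)) u) =
    \sum_(t : p.-tuple bool | good t) mu ^+ (count id t).-1 * term t.
Proof.
have y0 : mu *: u + v \in part g false by rewrite memvD ?memvZ.
have pE : p = (p - 3).+3 by rewrite -[LHS](subnK p_gt2) addn3.
have podd : odd p by case/even_prime: (pcharf_prime charKp) p_gt2 => [->|].
have sgn : (-1) ^+ p.-2 = -1 :> K.
  by rewrite -signr_odd; move: podd; rewrite pE /= negbK => ->.
(* Two signs cancel: one from swapping the arguments of [alpha], the other being (-1)^(p-2) with p
   odd. *)
rewrite /term (even_form_antisym gL alphaB) // (iter_br_foldl _ _ y0).
rewrite (bilfZl alphaB) sgn mulN1r opprK; move: (p - 3)%N pE => m ->.
rewrite left_normed_expansion -/x.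
rewrite (sum_tuple_cons (fun t => mu ^+ count id t *
    alpha (foldl br u (map x (take m.+1 t))) (x (nth false t m.+1)))).
rewrite (sum_tuple_true_false (fun t => mu ^+ (count id t).-1 *
  alpha (left_normed (map x (take m.+3.-1 t))) (x (nth false t m.+3.-1)))).
(* If the first chosen letter is u the word contains [u,u] = 0, so only words beginning with u, v
   survive. *)
rewrite big_bool big1 /= => [|t _].
  by rewrite add0r; apply: eq_bigr => t _; rewrite add0n.
by rewrite /= even_br_self ?char_neq2 // foldl_br0 (bilf0l alphaB) mulr0.
Qed.

(** A word beginning with u, v contains both letters, so its number of u's lies in 1, ..., p - 1 and
    grouping by that number misses no word. *)
Let sum_by_count (F : nat -> K) :
  \sum_(1 <= i < p) F i *
      \sum_(t : p.-tuple bool | good t && (count id t == i)) term t =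
    \sum_(t : p.-tuple bool | good t) F (count id t) * term t.
Proof.
under eq_bigr => i _ do rewrite big_mkcondr big_distrr /=.
rewrite exchange_big /=; apply: eq_bigr => t /andP[t0 t1].
have ct : count id t \in index_iota 1 p.
  rewrite mem_index_iota -has_count; apply/andP; split.
    apply/hasP; exists true => //.
    by rewrite -t0 mem_nth ?size_tuple ?(ltnW (ltnW p_gt2)).
  rewrite -[X in (_ < X)%N](size_tuple t) ltn_neqAle count_size andbT.
  rewrite -all_count; apply/negP => /allP /(_ (nth true t 1)) /=.
  by rewrite mem_nth ?size_tuple ?(ltnW p_gt2) // => /(_ isT); apply/negP.
rewrite (bigD1_seq _ ct (iota_uniq _ _)) /= eqxx big1 ?addr0 // => i /negbTE ni.
by rewrite eq_sym ni mulr0.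
Qed.

(* Expanding in mu, i * s_i is the sum of the words with i letters u, first
   letter u and, as [u,u] = 0, second letter v. The coefficients may be compared
   because K has at least p elements while the degree is at most p - 2. *)
Lemma jacobson_coefs_sum (s : nat -> K) :
  jacobson_coefs (V := K^o) p
    (fun mu => alpha (mu *: u + v) (iter p.-2 (br (mu *: u + v)) u)) s ->
  \sum_(1 <= i < p) s i =
    \sum_(t : p.-tuple bool | nth false t 0 && ~~ nth true t 1)
      (count id t)%:R^-1 *
        alpha (left_normed (map x (take p.-1 t))) (x (nth false t p.-1)).
Proof.
move=> sJ; rewrite -(sum_by_count (fun i => i%:R^-1)) !big_nat.
pose S i := \sum_(t : p.-tuple bool | good t && (count id t == i)) term t.
have sE i : (0 < i < p)%N -> i%:R * s i - S i = 0.
  apply: (poly_fun_eq0 charKp (c := fun i => i%:R * s i - S i)) => mu.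
  under eq_bigr => j _ do rewrite mulrBl [S _ * _]mulrC.
  rewrite sumrB (sum_by_count (fun i => mu ^+ i.-1)) -alpha_expansion sJ.
  by apply/eqP; rewrite subr_eq0; apply/eqP/eq_bigr => j _; rewrite mulrAC.
apply: eq_bigr => i ip; have /eqP := sE i ip; rewrite subr_eq0 => /eqP siE.
by rewrite -[X in _ = _ * X]/(S i) -siE mulKf // (natr_neq0 charKp).
Qed.

End Pair.

(** Used twice, for (C, P) and for (Omega, T). *)
Lemma jacobson_star_property :
  (forall k (a : g), a \in part g false -> beta (k *: a) = k ^+ p * beta a) ->
  (forall u v : g, u \in part g false -> v \in part g false ->
    exists s : nat -> K,
      jacobson_coefs (V := K^o) p
        (fun mu => alpha (mu *: u + v) (iter p.-2 (br (mu *: u + v)) u)) s /\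
      beta (u + v) = beta u + beta v + \sum_(1 <= i < p) s i) ->
  star_property p alpha beta.
Proof.
move=> betaZ betaD; split=> // u v u0 v0 x.
by have [s [sJ ->]] := betaD u v u0 v0; rewrite (jacobson_coefs_sum u0 v0 sJ).
Qed.

End StarProperty.

(** * Splitting off a hyperbolic plane *)

(* [j] embeds [a] onto the orthogonal of Span{x, xs}, and [q] is the projection
   along that plane; the bracket of [a] is the projected one. *)
Record splitting (K : fieldType) (g : superAlgebra K) (w : g -> g -> K)
    (x xs : g) (a : superAlgebra K) (j : 'Hom(a, g)) (q : 'Hom(g, a)) : Prop := {
  split_injK : cancel j q;
  split_decomp : forall v, v = w xs v *: x + j (q v) + w v x *: xs;
  split_xs : forall u, w xs (j u) = 0;
  split_x : forall u, w (j u) x = 0;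
  split_part : forall i u, (u \in part a i) = (j u \in part g i);
  split_br : forall u v, br u v = q (br (j u) (j v))
}.

Section SplittingExists.
Variables (K : fieldType) (g : superAlgebra K) (w : g -> g -> K) (x xs : g).
Hypothesis wB : is_bilinear (w : g -> g -> K^o).
Hypotheses (wxx : w x x = 0) (wxsxs : w xs xs = 0) (wxsx : w xs x = 1).

Definition split_space : {vspace g} :=
  (lker (linfun (w xs : g -> K^o)) :&: lker (linfun (w^~ x : g -> K^o)))%VS.

Lemma mem_split_space v : (v \in split_space) = (w xs v == 0) && (w v x == 0).
Proof.
by rewrite memv_cap !memv_ker !linear_linfunE //; [apply: wB.2 | apply: wB.1].
Qed.

Definition split_proj (v : g) : g := v - w xs v *: x - w v x *: xs.

Lemma split_proj_in v : split_proj v \in split_space.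
Proof.
rewrite mem_split_space !(bilfE wB) wxx wxsxs wxsx.
by rewrite !mulr0 !mulr1 subr0 oppr0 addr0 !subrr eqxx.
Qed.

Lemma split_proj_id v : v \in split_space -> split_proj v = v.
Proof.
rewrite mem_split_space => /andP[/eqP v0 /eqP v0'].
by rewrite /split_proj v0 v0' !scale0r !subr0.
Qed.

Definition split_algebra : superAlgebra K :=
  @SuperAlgebra K (subvs_of split_space)
    (fun i => linfun vsval @^-1: part g i)%VS
    (fun u v => vsproj split_space (split_proj (br (vsval u) (vsval v)))).

Lemma splitting_exists :
  exists (a : superAlgebra K) (j : 'Hom(a, g)) (q : 'Hom(g, a)),
    splitting w x xs j q.
Proof.
pose j : 'Hom(split_algebra, g) := linfun (@vsval K g split_space).
pose q : 'Hom(g, split_algebra) :=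
  (linfun (vsproj split_space) \o linfun split_proj)%VF.
have jE u : j u = vsval u by rewrite lfunE.
have qE v : q v = vsproj split_space (split_proj v).
  rewrite comp_lfunE lfunE linear_linfunE // => k u u'.
  rewrite /split_proj !(bilfE wB) !scalerDl !scalerBr !scalerA !opprD.
  by rewrite [RHS]addrACA (addrACA (k *: u)).
have j_in u : j u \in split_space by rewrite jE subvsP.
exists split_algebra, j, q; split.
- by move=> u; rewrite qE split_proj_id // jE vsvalK.
- move=> v; rewrite jE qE vsprojK ?split_proj_in // /split_proj.
  by rewrite addrA subrK addrC subrK.
- by move=> u; apply/eqP; have := j_in u; rewrite mem_split_space => /andP[].
- by move=> u; apply/eqP; have := j_in u; rewrite mem_split_space => /andP[].
- by move=> i u; rewrite /= -memv_preim.
- by move=> u v; rewrite qE !jE.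
Qed.

End SplittingExists.

(** * The extension data and their identities *)

Section Transport.
Variables (K : fieldType) (p : nat) (g h : superAlgebra K) (pm : g -> g).
Variables (f : 'Hom(g, h)) (f' : h -> g).
Hypotheses (fK : cancel f f') (f'K : cancel f' f).
Hypothesis f_even : forall u, u \in part g false -> f u \in part h false.
Hypothesis f'_even : forall t, t \in part h false -> f' t \in part g false.
Hypothesis f_br : forall u v, f (br u v) = br (f u) (f v).

(** The p-map of the extension is defined by transport along the isomorphism, so Jacobson's formula
    need not be proved again there. *)
Lemma transport_p2p_map : p2p_map p pm -> p2p_map p (fun t => f (pm (f' t))).
Proof.
case=> pmS pm_br.
have f'Z k t : f' (k *: t) = k *: f' t.
  by apply: (can_inj fK); rewrite linearZ /= !f'K.
have f'D t u : f' (t + u) = f' t + f' u.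
  by apply: (can_inj fK); rewrite linearD /= !f'K.
have f_iter n u v : f (iter n (br u) v) = iter n (br (f u)) (f v).
  by elim: n => //= n <-.
have br_fpm t u : t \in part h false -> br (f (pm (f' t))) u = iter p (br t) u.
  move=> /f'_even t0; rewrite -{1}[u]f'K -f_br pm_br // f_iter.
  by rewrite !f'K.
split=> //; split=> [t t0|t u t0 _|k t t0|t u t0 u0].
- exact/f_even/(pm_even pmS)/f'_even.
- exact: br_fpm.
- by rewrite f'Z (pm_scale pmS) ?linearZ ?f'_even.
have [s [sJ sE]] := pm_add pmS (f'_even t0) (f'_even u0).
exists (f \o s); split=> [mu|]; last by rewrite f'D sE !linearD linear_sum.
rewrite -{1}[t]f'K -{1}[u]f'K -{2}[t]f'K -linearP -f_iter sJ linear_sum.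
by apply: eq_bigr => i _; rewrite linearZ.
Qed.

End Transport.

Section Extension.
Variables (K : fieldType) (p : nat) (g : superAlgebra K).
Variables (pm : g -> g) (w : g -> g -> K) (x xs : g).
Hypothesis charKp : p \in [pchar K].
Hypothesis p_gt2 : (2 < p)%N.
Hypothesis gR : restricted_orthosymplectic_qf p pm w.
Hypotheses (x0 : x \in part g false) (xs0 : xs \in part g false).
Hypothesis wxsx : w xs x = 1.
Hypothesis w_x_br : forall u v, w x (br u v) = 0.
Hypothesis x_ideal : forall u, exists k, br u x = k *: x.
Hypothesis pm_perp : forall u, u \in part g false -> w u x = 0 -> w (pm u) x = 0.

Let gL := roqf_lie gR.
Let brB := br_bilinear gL.
Let wQ := roqf_qf gR.
Let wB := qf_bilinear wQ.
Let wA := qf_antisym wQ.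
Let wE := roqf_even gR.
Let pmS := (roqf_pm gR).1.
Let char2 := char_neq2 charKp p_gt2.
Let p_pos : (0 < p)%N. Proof. exact: ltn_trans p_gt2. Qed.
Let p_odd : odd p.
Proof. by case/even_prime: (pcharf_prime charKp) p_gt2 => [->|]. Qed.
Let pE : p = p.-2.+2.
Proof. by rewrite -[LHS](subnK (ltnW p_gt2)) addn2 subn2. Qed.
Let p1E : p = p.-1.+1. Proof. by rewrite prednK. Qed.
Let p2E : p.-1 = p.-2.+1. Proof. by rewrite {1}pE. Qed.

(** * Brackets with x *)

Lemma even_form_self u : u \in part g false -> w u u = 0.
Proof.
move=> u0; apply/eqP; have /eqP := even_form_antisym gL wB wA u0 u.
rewrite -addr_eq0 -mulr2n -mulr_natl mulf_eq0.
by move: char2; rewrite inE /= => /negbTE ->.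
Qed.

Let wxx : w x x = 0 := even_form_self x0.
Let wxsxs : w xs xs = 0 := even_form_self xs0.
Let wxxs : w x xs = -1.
Proof. by rewrite (even_form_antisym gL wB wA x0) wxsx. Qed.

Lemma w_br_x u v : w (br u v) x = 0.
Proof.
by apply/eqP; rewrite -oppr_eq0 -(even_form_antisym gL wB wA x0) w_x_br.
Qed.

(** Closedness on (xs, x, u): the third term pairs x with a bracket and vanishes. *)
Lemma w_xs_br_x u : w xs (br x u) = - w u (br xs x).
Proof.
elim/(part_ind gL): u => [u v Hu Hv|i u ui].
  by rewrite !(bilE brB) (bilfDl wB) (bilfDr wB) Hu Hv opprD.
have := qf_closed wQ xs0 x0 ui; rewrite /= andbF !mul1r w_x_br addr0.
by move/eqP; rewrite addr_eq0 => /eqP.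
Qed.

Let lam := w xs (br x xs).

Lemma br_x_xs : br x xs = lam *: x.
Proof.
rewrite /lam (even_br_antisym gL xs x0); have [k ->] := x_ideal xs.
by rewrite -scaleNr (bilfZr wB) wxsx mulr1.
Qed.

Lemma br_xs_x : br xs x = - lam *: x.
Proof. by rewrite (even_br_antisym gL x xs0) br_x_xs scaleNr. Qed.

(** As [x,u] is a multiple of x, its coefficient is w(xs,[x,u]), which equals lam w(u,x) by
    [w_xs_br_x]. *)
Lemma br_x_perp u : w u x = 0 -> br x u = 0.
Proof.
move=> ux; rewrite (even_br_antisym gL u x0); have [k ku] := x_ideal u.
have := w_xs_br_x u; rewrite (even_br_antisym gL u x0) ku br_xs_x !(bilfE wB).
rewrite ux wxsx mulr1 mulr0 oppr0 => /eqP; rewrite oppr_eq0 => /eqP ->.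
by rewrite scale0r oppr0.
Qed.

Lemma br_perp_x u : w u x = 0 -> br u x = 0.
Proof.
by move/br_x_perp/eqP; rewrite (even_br_antisym gL u x0) oppr_eq0 => /eqP.
Qed.

(** * The structure induced on [a] *)

Variables (a : superAlgebra K) (j : 'Hom(a, g)) (q : 'Hom(g, a)).
Hypothesis aS : splitting w x xs j q.

Let jK := split_injK aS.
Let decomp := split_decomp aS.
Let partE := split_part aS.
Let abrE := split_br aS.
Let wxsj := split_xs aS.
Let wjx := split_x aS.

Let wxj u : w x (j u) = 0.
Proof. by rewrite (even_form_antisym gL wB wA x0) wjx oppr0. Qed.
Let wjxs u : w (j u) xs = 0.
Proof.
by apply/eqP; rewrite -oppr_eq0 -(even_form_antisym gL wB wA xs0) wxsj.
Qed.

Lemma split_inj : injective j. Proof. exact: can_inj jK. Qed.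

Lemma split_q_x : q x = 0.
Proof.
apply: split_inj; apply: (addrI x); rewrite linear0 addr0.
by have := decomp x; rewrite wxsx wxx scale1r scale0r addr0.
Qed.

Lemma split_q_xs : q xs = 0.
Proof.
apply: split_inj; apply: (addIr xs); rewrite linear0 add0r.
by have := decomp xs; rewrite wxsx wxsxs scale1r scale0r add0r.
Qed.

Lemma split_q_part i v : v \in part g i -> q v \in part a i.
Proof.
move=> vi; rewrite partE.
have -> : j (q v) = v - w xs v *: x - w v x *: xs.
  by rewrite {2}[v]decomp [X in X - _]addrAC addrK (addrC _ (j _)) addrK.
case: i vi => [v1|v0]; last by rewrite !rpredB ?rpredZ.
have [_ ->] := wE x0 v1; have [-> _] := wE xs0 v1.
by rewrite !scale0r !subr0.
Qed.

(* The component of [u,v] along x; it equals C(u,v), see [split_cE]. *)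
Let c u v := w xs (br (j u) (j v)).

Lemma br_jj u v : br (j u) (j v) = j (br u v) + c u v *: x.
Proof. by rewrite {1}[br (j u) _]decomp -abrE w_br_x scale0r addr0 addrC. Qed.

Lemma br_jx u : br (j u) x = 0. Proof. exact: br_perp_x. Qed.
Lemma br_xj u : br x (j u) = 0. Proof. exact: br_x_perp. Qed.

(** The x-component of the inner bracket is killed by [j u]; hence the Jacobi identity of g passes
    to [a]. *)
Lemma br_j_jbr u v z : br (j u) (j (br v z)) = br (j u) (br (j v) (j z)).
Proof. by rewrite (br_jj v z) (bilDr brB) (bilZr brB) br_jx scaler0 addr0. Qed.

Lemma br_jbr_j u v z : br (j (br u v)) (j z) = br (br (j u) (j v)) (j z).
Proof. by rewrite (br_jj u v) (bilDl brB) (bilZl brB) br_xj scaler0 addr0. Qed.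

(** The outermost bracket is left unprojected: its x-component is a value of C. *)
Lemma iter_br_j n u v :
  iter n.+1 (br (j u)) (j v) = br (j u) (j (iter n (br u) v)).
Proof. by elim: n => // n IHn; rewrite iterS IHn iterS br_j_jbr. Qed.

Lemma split_lie : lie_superalgebra a.
Proof.
split.
- apply/eqP; rewrite eqEsubv subvf; apply/subvP => u _.
  have [v0 [v1 [v00 v11 uE]]] := part_decomp gL (j u).
  by rewrite -[u]jK uE linearD memv_add ?split_q_part.
- apply/eqP; rewrite -subv0; apply/subvP => u; rewrite memv_cap memv0 !partE.
  case/andP => u0 u1; apply/eqP/split_inj; rewrite linear0.
  exact: part_disjoint gL _ _ u0 u1.
- by split=> [u|v] k u1 u2;
    rewrite /= !abrE linearD linearZ !(bilE brB) linearD linearZ.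
- move=> i i' u v; rewrite !partE => ui vi'; rewrite -partE abrE.
  exact/split_q_part/(br_part gL).
- move=> i i' u v; rewrite !partE => ui vi'.
  by rewrite !abrE (br_antisym gL ui vi') linearN linearZ.
- move=> i i' i'' u v z; rewrite !partE => ui vi' zi''.
  rewrite (abrE u) (abrE (br u v)) (abrE v (br u z)) !br_j_jbr br_jbr_j.
  by rewrite (br_jacobi gL ui vi' zi'') linearD linearZ.
- move=> u; rewrite partE => u1.
  by rewrite abrE br_j_jbr (br_cube gL u1) linear0.
Qed.

Let wa (u v : a) := w (j u) (j v).

Lemma split_waB : is_bilinear (wa : a -> a -> K^o).
Proof. by split=> [u|v] k u1 u2; rewrite /wa linearP !(bilfE wB). Qed.

(** Projecting a bracket changes it by a multiple of x, orthogonal to the image of [j], so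
    closedness survives. A vector in the radical of [wa] is also orthogonal to x and xs, hence
    zero. *)
Lemma split_qf : quasi_frobenius wa.
Proof.
split; first exact: split_waB.
- by move=> i i' u v; rewrite !partE; apply: wA.
- move=> i i' i'' u v z; rewrite !partE /wa => ui vi' zi''.
  rewrite -(qf_closed wQ ui vi' zi'') !br_jj !(bilfDr wB) !(bilfZr wB) !wjx.
  by rewrite !mulr0 !addr0.
- move=> u u0; apply: split_inj; rewrite linear0.
  apply: (qf_nondegenerate wQ) => v.
  have u0' v' : w (j u) (j v') = 0 := u0 v'.
  by rewrite [v]decomp !(bilfE wB) wjx wjxs u0' !mulr0 !addr0.
Qed.

Lemma split_even_form : even_form wa.
Proof. by move=> u v; rewrite !partE; apply: wE. Qed.

Let pma u := q (pm (j u)).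
Let P u := w xs (pm (j u)).

(** The p-ideal hypothesis excludes an xs-component. *)
Lemma pm_j u : u \in part a false -> pm (j u) = j (pma u) + P u *: x.
Proof.
rewrite partE => u0; rewrite {1}[pm _]decomp pm_perp ?wjx //.
by rewrite scale0r addr0 addrC.
Qed.

Lemma br_pm_j u v : u \in part a false ->
  br (j (pma u)) (j v) = iter p (br (j u)) (j v).
Proof.
move=> u0; have := (roqf_pm gR).2 (j u) (j v); rewrite -partE => <- //.
by rewrite pm_j // !(bilE brB) br_xj scaler0 addr0.
Qed.

(** One family of coefficients in g serves twice: its [a]-components give the p-structure of [a],
    its x-components the additivity of P. *)
Lemma split_jacobson u v s :
  jacobson_coefs p (fun mu => iter p.-1 (br (mu *: j u + j v)) (j u)) s ->
  jacobson_coefs p (fun mu => iter p.-1 (br (mu *: u + v)) u) (q \o s) /\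
  jacobson_coefs (V := K^o) p
    (fun mu => c (mu *: u + v) (iter p.-2 (br (mu *: u + v)) u)) (w xs \o s).
Proof.
have iterE mu : iter p.-1 (br (mu *: j u + j v)) (j u) =
    br (j (mu *: u + v)) (j (iter p.-2 (br (mu *: u + v)) u)).
  by rewrite p2E -linearP iter_br_j.
move=> sJ; split=> mu; have := sJ mu; rewrite iterE => {}sJ.
  rewrite p2E iterS abrE sJ linear_sum.
  by apply: eq_bigr => i _; rewrite linearZ.
rewrite /c sJ (big_morph _ (bilfDr wB xs) (bilf0r wB xs)).
by apply: eq_bigr => i _; rewrite (bilfZr wB).
Qed.

Lemma split_pmZ k u : u \in part a false ->
  pma (k *: u) = k ^+ p *: pma u /\ P (k *: u) = k ^+ p * P u.
Proof.
rewrite partE => u0; rewrite /pma /P linearZ (pm_scale pmS) //.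
by rewrite linearZ (bilfZr wB).
Qed.

Lemma split_pmD u v : u \in part a false -> v \in part a false ->
  exists s : nat -> g,
    [/\ jacobson_coefs p (fun mu => iter p.-1 (br (mu *: u + v)) u) (q \o s),
        jacobson_coefs (V := K^o) p
          (fun mu => c (mu *: u + v) (iter p.-2 (br (mu *: u + v)) u))
          (w xs \o s),
        pma (u + v) = pma u + pma v + \sum_(1 <= i < p) q (s i)
      & P (u + v) = P u + P v + \sum_(1 <= i < p) w xs (s i)].
Proof.
rewrite !partE => u0 v0; have [s [sJ sE]] := pm_add pmS u0 v0.
exists s; have [s1 s2] := split_jacobson sJ; split=> //.
  by rewrite /pma linearD sE !linearD linear_sum.
rewrite /P linearD sE !(bilfDr wB).
by rewrite (big_morph _ (bilfDr wB xs) (bilf0r wB xs)).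
Qed.

Lemma split_p2p : p2p_map p pma.
Proof.
have br_pma u v : u \in part a false -> br (pma u) v = iter p (br u) v.
  by move=> u0; rewrite abrE br_pm_j // p1E iter_br_j -abrE.
split=> //; split=> [u|u v u0 _|k u|u v u0 v0].
- by rewrite partE => u0; rewrite split_q_part ?(pm_even pmS).
- exact: br_pma.
- by move=> u0; have [-> _] := split_pmZ k u0.
- by have [s [s1 _ s2 _]] := split_pmD u0 v0; exists (q \o s).
Qed.

Lemma split_roqf : restricted_orthosymplectic_qf p pma wa.
Proof.
by split; [apply: split_lie | apply: split_p2p | apply: split_qf |
  apply: split_even_form].
Qed.

(** Reads off the two components of an identity in j(a) + Kx. *)
Lemma split_pair_inj u v k l : j u + k *: x = j v + l *: x -> u = v /\ k = l.
Proof.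
move=> E; split.
  have := congr1 q E.
  by rewrite !linearD !linearZ /= !jK split_q_x !scaler0 !addr0.
have := congr1 (w xs) E.
by rewrite !(bilfDr wB) !(bilfZr wB) !wxsj wxsx !mulr1 !add0r.
Qed.

(** * The derivation D, its adjoint and Z_Omega *)

Definition split_D : 'End(a) := (q \o linfun (br xs) \o j)%VF.
Let D := split_D.

(* The component of [xs,u] along x; it is represented by Z_Omega. *)
Let f u := w xs (br xs (j u)).

Lemma split_DE u : D u = q (br xs (j u)).
Proof. by rewrite !comp_lfunE linear_linfunE //; apply: brB.1. Qed.

Lemma br_xsj u : br xs (j u) = j (D u) + f u *: x.
Proof.
by rewrite {1}[br xs _]decomp -split_DE w_br_x scale0r addr0 addrC.
Qed.

Lemma br_jxs u : br (j u) xs = - (j (D u) + f u *: x).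
Proof. by rewrite -br_xsj (even_br_antisym gL _ xs0) opprK. Qed.

Lemma split_D_part i u : u \in part a i -> D u \in part a i.
Proof.
by rewrite partE split_DE => ui; apply/split_q_part/(br_part gL xs0 ui).
Qed.

(** The components of the Jacobi identity for xs, [j u], [j v]; the term in lam comes from
    [xs, C(u,v) x]. *)
Lemma split_D_br u v : D (br u v) = br (D u) v + br u (D v) /\
  f (br u v) - lam * c u v = c (D u) v + c u (D v).
Proof.
have := even_br_jacobi gL (j u) (j v) xs0.
rewrite (br_jj u v) (bilDr brB) (bilZr brB) br_xs_x br_xsj.
rewrite !br_xsj (bilDl brB) (bilZl brB) br_xj scaler0 addr0.
rewrite (bilDr brB) (bilZr brB) br_jx scaler0 addr0 !br_jj.
rewrite scalerA -addrA -scalerDl addrACA -linearD -scalerDl.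
by move/split_pair_inj => [-> <-]; rewrite mulrN mulrC.
Qed.

Lemma split_adjoint_exists :
  exists Ds : 'End(a), forall u v, wa (Ds u) v = wa u (D v).
Proof. exact: (form_adjoint split_waB (qf_nondegenerate split_qf)). Qed.

Lemma split_Z_exists : exists Z : a, forall u, wa Z u = f u.
Proof.
have [Z ZE] := form_represents split_waB (qf_nondegenerate split_qf)
  (linfun (f : a -> K^o)).
exists Z => u; rewrite ZE linear_linfunE // => k u1 u2.
by rewrite /f linearD linearZ !(bilE brB) !(bilfE wB).
Qed.

Variables (Ds : 'End(a)) (Z : a).
Hypothesis DsE : forall u v, wa (Ds u) v = wa u (D v).
Hypothesis ZE : forall u, wa Z u = f u.

Let waB := split_waB.
Let aL := split_lie.
Let waE := split_even_form.
Let waN := qf_nondegenerate split_qf.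
Let waA := qf_antisym split_qf.

Lemma split_Ds_part i u : u \in part a i -> Ds u \in part a i.
Proof.
move=> ui; apply: (represented_part aL waB waE waN) => v vi.
by rewrite DsE (even_form_neq waE ui) // split_D_part.
Qed.

Lemma split_Z_even : Z \in part a false.
Proof.
apply: (represented_part aL waB waE waN) => v; rewrite partE => v1.
by rewrite ZE /f (wE xs0 _).1 // (br_part gL xs0 v1).
Qed.

(** [DsE] has the adjoint on the left. Swapping arguments on both sides costs the same sign, since D
    and [Ds] preserve parity. *)
Lemma split_adjoint u v : wa (D u) v = wa u (Ds v).
Proof.
pose w1 u v := wa (D u) v; pose w2 u v := wa u (Ds v).
apply: (form_ext_part aL _ (w := w1) (w' := w2)) => [||i i' {}u {}v ui vi'].
- by split=> [u1|v1] k u2 v2; rewrite /w1 /= ?linearP !(bilfE waB).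
- by split=> [u1|v1] k u2 v2; rewrite /w2 /= ?linearP !(bilfE waB).
rewrite /w1 /w2 (waA (split_D_part ui) vi') -DsE (waA ui (split_Ds_part vi')).
by [].
Qed.

(** Closedness of w on (xs, [j u], [j v]), where [xs, _] becomes D up to multiples of x. *)
Lemma split_cE u v : c u v = wa (D u + Ds u) v.
Proof.
pose w2 u v := wa (D u + Ds u) v.
apply: (form_ext_part aL _ (w := c) (w' := w2)) => [||i i' {}u {}v ui vi'].
- by split=> [u1|v1] k u2 v2;
    rewrite /c /= linearD linearZ !(bilE brB) !(bilfE wB).
- split=> [u1|v1] k u2 v2; rewrite /w2 /= ?(linearD, linearZ) !(bilfE waB) .
    by rewrite addrACA -mulrDr.
  by rewrite addrACA -mulrDr.
rewrite /w2 (bilfDl waB) DsE (waA (split_D_part ui) vi').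
have := qf_closed wQ xs0; rewrite !partE in ui vi'; move/(_ _ _ _ _ ui vi').
rewrite /= !mul1r br_jxs br_xsj.
rewrite (bilfNr wB) !(bilfDr wB) !(bilfZr wB) !wjx !mulr0 !addr0 -addrA.
by move/eqP; rewrite addr_eq0 => /eqP; rewrite /c andbC andbF mul1r opprD opprK.
Qed.

(** The components of ad(u^[p]) xs = ad(u)^p xs: D is restricted, and T is the functional [f] of
    u^[p]. *)
Lemma split_D_pm u : u \in part a false ->
  D (pma u) = iter p.-1 (br u) (D u) /\
  f (pma u) = c u (iter p.-2 (br u) (D u)) + lam * P u.
Proof.
move=> u0; have u0' : j u \in part g false by rewrite -partE.
have: br xs (pm (j u)) = br (j u) (j (iter p.-2 (br u) (D u))).
  rewrite -[RHS](iter_br_j p.-2) (even_br_antisym gL _ xs0) (roqf_pm gR).2 //.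
  rewrite {1}pE iterSr br_jxs.
  have iterN n v : iter n (br (j u)) (- v) = - iter n (br (j u)) v.
    by elim: n => //= n ->; rewrite (bilNr brB).
  rewrite iterN opprK !iterSr (bilDr brB) (bilZr brB) br_jx scaler0 addr0.
  by [].
rewrite pm_j // (bilDr brB) (bilZr brB) br_xs_x br_xsj br_jj.
rewrite -addrA scalerA -scalerDl.
by move/split_pair_inj => [-> <-]; rewrite p2E mulrN (mulrC lam) addrNK.
Qed.

(** * The p-th powers of xs and x *)

Let gam := w (pm xs) x.
Let a0 := q (pm xs).
Let lt := w xs (pm xs).
Let b0 := q (pm x).
Let sg := w xs (pm x).
Let dl := w (pm x) x.

(** As [xs,x] = -lam x, the x-component created by the (i+1)-st bracket is scaled by -lam in each of
    the n - i - 1 later ones. *)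
Lemma iter_br_xs n u : iter n (br xs) (j u) =
  j (iter n D u) + (\sum_(i < n) (- lam) ^+ (n - i.+1) * f (iter i D u)) *: x.
Proof.
elim: n => [|n IHn]; first by rewrite big_ord0 scale0r addr0.
rewrite iterS IHn (bilDr brB) (bilZr brB) br_xs_x br_xsj.
rewrite -addrA scalerA -scalerDl.
congr (_ + _ *: x); rewrite big_ord_recr /= subnn mul1r addrC; congr (_ + _).
rewrite mulr_suml; apply: eq_bigr => i _.
by rewrite subSS -(subnSK (ltn_ord i)) exprSr mulrAC.
Qed.

Lemma iter_wa_Ds n u v : wa (iter n Ds u) v = wa u (iter n D v).
Proof. by elim: n v => // n IHn v; rewrite iterS DsE IHn -iterSr. Qed.

Lemma br_pm_xs u : br (pm xs) (j u) =
  j (br a0 u + gam *: D u) + (c a0 u + gam * f u) *: x.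
Proof.
rewrite {1}[pm xs]decomp !(bilDl brB) !(bilZl brB) br_xj scaler0 add0r.
rewrite br_jj br_xsj scalerDr scalerA addrACA -scalerDl.
by rewrite linearD linearZ.
Qed.

Lemma split_D_iter u : iter p D u = gam *: D u + br a0 u /\
  c a0 u + gam * f u = \sum_(i < p) (- lam) ^+ (p - i.+1) * f (iter i D u).
Proof.
have := br_pm_xs u; rewrite (roqf_pm gR).2 // iter_br_xs.
by case/split_pair_inj => -> ->; rewrite addrC.
Qed.

Lemma split_D_a0 : D a0 = 0 /\ f a0 = lam * lt.
Proof.
have: br xs (pm xs) = 0.
  rewrite (even_br_antisym gL _ xs0) (roqf_pm gR).2 // pE iterSr.
  rewrite (even_br_self gL char2 xs0); apply/eqP; rewrite oppr_eq0; apply/eqP.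
  by elim: (p.-2.+1) => //= n ->; rewrite (bil0r brB).
rewrite {1}[pm xs]decomp !(bilDr brB) !(bilZr brB) br_xs_x br_xsj.
rewrite (even_br_self gL char2 xs0) scaler0 addr0 addrCA scalerA -scalerDl.
rewrite -[RHS](linear0 j) -[RHS]addr0 -[in RHS](scale0r x).
by move/split_pair_inj => [-> /eqP]; rewrite mulrN addrC subr_eq0 mulrC => /eqP.
Qed.

(** One formula for all cases: if lam = 0 only the last term survives, otherwise the term i = 0
    cancels gam Z. *)
Lemma split_Ds_a0 : Ds a0 + gam *: Z =
  \sum_(i < p) (- lam) ^+ (p - i.+1) *: iter i Ds Z.
Proof.
apply/eqP; rewrite -subr_eq0; apply/eqP/waN => u.
have [_] := split_D_iter u; rewrite split_cE (split_D_a0).1 add0r.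
rewrite !(bilfDl waB) (bilfNl waB) (bilfZl waB) ZE => ->.
rewrite (big_morph (wa^~ u) (fun y z => bilfDl waB y z u) (bilf0l waB u)).
apply/eqP; rewrite subr_eq0; apply/eqP/eq_bigr => i _.
by rewrite (bilfZl waB) iter_wa_Ds ZE.
Qed.

(** Apply ad(xs^[p]) = ad(xs)^p to x, which gives -gam lam = (-lam)^p, and cancel lam. *)
Lemma split_gamma : lam != 0 -> gam = lam ^+ p.-1.
Proof.
move=> lam0; have := (roqf_pm gR).2 xs x xs0.
have -> : iter p (br xs) x = (- lam) ^+ p *: x.
  elim: p => [|n IHn]; first by rewrite scale1r.
  by rewrite iterS IHn (bilZr brB) br_xs_x scalerA exprSr.
rewrite {1}[pm xs]decomp !(bilDl brB) !(bilZl brB) br_jx br_xs_x.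
rewrite (even_br_self gL char2 x0) scaler0 !add0r scalerA => /(congr1 (w xs)).
rewrite !(bilfZr wB) wxsx !mulr1 {1}p1E exprSr => /mulIf.
rewrite oppr_eq0 -/gam => /(_ lam0) ->.
rewrite exprNn -signr_odd; move: p_odd; rewrite {1}p1E /= => /negbTE ->.
by rewrite mul1r.
Qed.

(** ad(x) maps g into Kx and kills x, so its p-th power is zero. Evaluating at x, xs and [j u]
    yields the conditions on delta, b0 and sigma. *)
Lemma pm_x_central v : br (pm x) v = 0.
Proof.
rewrite (roqf_pm gR).2 // pE !iterSr.
have -> : br x (br x v) = 0.
  rewrite (even_br_antisym gL v x0); have [k ->] := x_ideal v.
  by rewrite !(bilE brB) (even_br_self gL char2 x0) scaler0 oppr0.
by elim: p.-2 => //= n ->; rewrite (bil0r brB).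
Qed.

Lemma split_delta_lambda : dl * lam = 0.
Proof.
have := pm_x_central x; rewrite [pm x]decomp !(bilDl brB) !(bilZl brB).
rewrite br_jx br_xs_x (even_br_self gL char2 x0) scaler0 !add0r scalerA.
move/(congr1 (w xs)); rewrite (bilfZr wB) wxsx mulr1 (bilf0r wB) mulrN.
by move/eqP; rewrite oppr_eq0 => /eqP.
Qed.

Lemma split_D_b0 : D b0 = 0 /\ f b0 = sg * lam.
Proof.
have := pm_x_central xs; rewrite {1}[pm x]decomp !(bilDl brB) !(bilZl brB).
rewrite br_x_xs br_jxs (even_br_self gL char2 xs0) scaler0 addr0 scalerA.
move/eqP; rewrite subr_eq0 => /eqP; rewrite -[LHS]add0r -[in LHS](linear0 j).
by move/split_pair_inj => [-> ->].
Qed.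

Lemma split_br_b0 u : br b0 u = - (dl *: D u) /\ c b0 u = - (dl * f u).
Proof.
have := pm_x_central (j u); rewrite {1}[pm x]decomp !(bilDl brB) !(bilZl brB).
rewrite br_xj scaler0 add0r br_jj br_xsj => /eqP.
rewrite addr_eq0 => /eqP; rewrite scalerDr opprD scalerA.
rewrite -scaleNr -[- (_ *: x)]scaleNr -linearZ.
by move/split_pair_inj => [-> ->]; rewrite scaleNr.
Qed.

Lemma split_Ds_b0 : Ds b0 = - dl *: Z.
Proof.
apply/eqP; rewrite -subr_eq0; apply/eqP/waN => u.
have [_] := split_br_b0 u; rewrite split_cE (split_D_b0).1 add0r.
by rewrite (bilfDl waB) (bilfNl waB) (bilfZl waB) ZE => ->; rewrite mulNr subrr.
Qed.

(** * Cocycle conditions and the three cases *)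

Definition split_ext : extData a :=
  ExtData D Ds gam a0 lam P Z b0 lt sg dl.
Let e := split_ext.

Lemma split_eC u v : eC wa e u v = c u v.
Proof. by rewrite /eC /= split_cE. Qed.

Lemma split_eCB : is_bilinear (eC wa e : a -> a -> K^o).
Proof.
split=> [u|v] k u1 u2; rewrite !split_eC /c /= ?(linearD, linearZ).
  by rewrite !(bilE brB) !(bilfE wB).
by rewrite !(bilE brB) !(bilfE wB).
Qed.

Lemma split_eC_antisym : super_antisymmetric (eC wa e).
Proof.
move=> i i' u v; rewrite !split_eC !partE => ui vi'; rewrite /c.
by rewrite (br_antisym gL ui vi') (bilfNr wB) (bilfZr wB).
Qed.

(** C(u,v) = w(xs,[u,v]), so closedness is the graded Jacobi identity under w(xs, _). *)
Lemma split_eC_closed : closed_form (eC wa e).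
Proof.
move=> i i' i'' u v z; rewrite !split_eC !partE => ui vi' zi''; rewrite /c.
rewrite !br_j_jbr.
have uv := br_part gL ui vi'; have zu := br_part gL zi'' ui.
rewrite (br_jacobi gL ui vi' zi'').
rewrite (br_antisym gL zi'' uv) (br_antisym gL zi'' ui).
rewrite !(bilE brB) !(bilfE wB).
by case: i i' i'' {ui vi' zi'' uv zu} => [] [] [] /=; ring.
Qed.

(** Both C(Du,v) and C(u,Dv), the latter after moving D to the left, contain [Ds] D u; hence the
    coefficient 2. *)
Lemma split_eOmega u v : eOmega wa e u v = wa Z (br u v).
Proof.
have [_ E] := split_D_br u v.
have -> : wa Z (br u v) = c (D u) v + c u (D v) + lam * c u v.
  by rewrite -E ZE subrK.
rewrite !split_cE -DsE /eOmega /= !linearD !(bilfE waB).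
by ring.
Qed.

Lemma split_eT u : u \in part a false -> eT p wa e u = wa Z (pma u).
Proof.
move=> u0; rewrite ZE (split_D_pm u0).2 -split_eC /eT /eC /=.
by [].
Qed.

Lemma split_CP_cocycle : cocycle2 p pma (eC wa e) (eP e).
Proof.
split; [split|exact: split_eC_closed|].
- exact: split_eCB.
- exact: split_eC_antisym.
- apply: (jacobson_star_property aL split_eCB charKp p_gt2).
    exact: split_eC_antisym.
    by move=> k u u0; have [_] := split_pmZ k u0.
  move=> u v u0 v0; have [s [_ sJ _ sE]] := split_pmD u0 v0.
  by exists (w xs \o s); split=> // mu; rewrite split_eC sJ.
move=> u v u0 v0; rewrite !split_eC; apply/eqP; rewrite subr_eq0; apply/eqP.
have v0' : j v \in part g false by rewrite -partE.
have iterR n : iter n (br^~ v) u = (-1) ^+ n *: iter n (br v) u.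
  elim: n => [|n IHn]; first by rewrite scale1r.
  rewrite iterS IHn (bilZl (br_bilinear aL)) -[br (iter _ _ _) v]opprK.
  by rewrite -(even_br_antisym aL _ v0) exprSr -scalerA scaleN1r.
(* The x-component of [v^[p],u] = ad(v)^p u is the cocycle condition; right brackets agree with
   ad(v) here because p - 1 is even. *)
have := br_pm_j u v0; rewrite p1E iter_br_j -p1E => E.
have Ec : c (pma v) u = c v (iter p.-1 (br v) u) by rewrite /c E.
have cA : forall y z, y \in part a false -> c y z = - c z y.
  move=> y z y0; rewrite -!split_eC.
  exact: (even_form_antisym aL split_eCB split_eC_antisym y0).
have -> : iter p.-1 (br^~ v) u = iter p.-1 (br v) u.
  rewrite iterR -signr_odd; move: p_odd; rewrite {1}p1E /= => /negbTE ->.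
  by rewrite scale1r.
by rewrite (cA u) // Ec (cA v) // opprK.
Qed.

Lemma split_OmegaB : is_bilinear (eOmega wa e : a -> a -> K^o).
Proof.
split=> [u|v] k u1 u2; rewrite !split_eOmega !(bilE (br_bilinear aL)).
  by rewrite !(bilfE waB).
by rewrite !(bilfE waB).
Qed.

Lemma split_Omega_antisym : super_antisymmetric (eOmega wa e).
Proof.
move=> i i' u v ui vi'; rewrite !split_eOmega.
by rewrite (br_antisym aL ui vi') (bilfNr waB) (bilfZr waB).
Qed.

(** With phi = w(Z, _), T is phi of the p-map, so its *-property is the image under phi of
    Jacobson's formula in [a]. *)
Lemma split_OmegaT_coboundary : coboundary2 p pma (eOmega wa e) (eT p wa e).
Proof.
split; first split.
- exact: split_OmegaB.
- exact: split_Omega_antisym.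
- apply: (jacobson_star_property aL split_OmegaB charKp p_gt2).
    exact: split_Omega_antisym.
    move=> k u u0; rewrite !split_eT ?memvZ //.
    by rewrite (split_pmZ k u0).1 (bilfZr waB).
  move=> u v u0 v0; have [s [sJ _ sE _]] := split_pmD u0 v0.
  exists (fun i => wa Z (q (s i))); split.
    move=> mu; rewrite split_eOmega -iterS -p2E sJ.
    rewrite (big_morph _ (bilfDr waB Z) (bilf0r waB Z)).
    by apply: eq_bigr => i _; rewrite (bilfZr waB).
  rewrite !split_eT ?memvD // sE !(bilfDr waB).
  by rewrite (big_morph _ (bilfDr waB Z) (bilf0r waB Z)).
exists (linfun (wa Z : a -> K^o)); split=> [u v|u u0].
  by rewrite split_eOmega linear_linfunE //; apply: waB.1.
by rewrite split_eT // linear_linfunE //; apply: waB.1.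
Qed.

Lemma split_ext_ok : ext_data_ok p pma wa e.
Proof.
split.
- split; first by split=> [i u|i u v _]; rewrite ?addbF ?scale1r;
    [apply: split_D_part | apply: (split_D_br u v).1].
  by move=> u u0; apply: (split_D_pm u0).1.
- by move=> i u v _; rewrite andbF mul1r split_adjoint.
- by rewrite /= split_q_part // (pm_even pmS).
- by move=> u; apply: (split_D_iter u).1.
- exact: split_D_a0.1.
- by move=> k u u0; have [_] := split_pmZ k u0.
- move=> u v u0 v0; have [s [_ sJ _ sE]] := split_pmD u0 v0.
  by exists (w xs \o s); split=> // mu; rewrite -sJ -split_eC.
- exact: split_CP_cocycle.
- exact: split_OmegaT_coboundary.
- exact: split_Z_even.
- exact: split_eOmega.
- exact: split_eT.
- by rewrite /= split_q_part // (pm_even pmS).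
Qed.

Lemma split_cases : [\/ ext_case_a p wa e, ext_case_b p wa e | ext_case_c p wa e].
Proof.
have [Da0 fa0] := split_D_a0; have [Db0 fb0] := split_D_b0.
have Dsb0 := split_Ds_b0; have Dsa0 := split_Ds_a0.
have [lam0|lam0] := eqVneq lam 0.
  have Za0 : wa Z a0 = 0 by rewrite ZE fa0 lam0 mul0r.
  have Zb0 : wa Z b0 = 0 by rewrite ZE fb0 lam0 mulr0.
  have Dsa0' : Ds a0 + gam *: Z = iter p.-1 Ds Z.
    rewrite Dsa0 lam0 oppr0 p1E big_ord_recr /= subnn scale1r big1 ?add0r //.
    by move=> i _; rewrite subSS expr0n subn_eq0 leqNgt ltn_ord scale0r.
  have [dl0|dl0] := eqVneq dl 0.
    apply: Or32; split; split=> //.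
      by split=> //=; rewrite Dsb0 dl0 oppr0 scale0r.
    by move=> u; rewrite /= (split_br_b0 u).1 dl0 scale0r oppr0.
  apply: Or33; split; split=> //=.
  move=> u; rewrite (split_br_b0 u).1 scalerN scaleNr opprK scalerA.
  by rewrite mulVf ?scale1r.
have dl0 : dl = 0.
  have /eqP := split_delta_lambda.
  by rewrite mulf_eq0 (negbTE lam0) orbF => /eqP.
apply: Or31; split; split=> //=.
- by rewrite ZE fa0 mulKf.
- exact: split_gamma.
- by rewrite Dsb0 dl0 oppr0 scale0r.
- by rewrite ZE fb0 mulrC mulfK.
- by move=> u; rewrite (split_br_b0 u).1 dl0 scale0r oppr0.
(* The missing term i = 0 of the sum is (-lam)^(p-1) Z = gam Z, as p - 1 is even. *)
apply: (addIr (gam *: Z)); rewrite Dsa0 p1E big_ord_recl /= addrC.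
congr (_ + _); last first.
  rewrite subn1 /= split_gamma // exprNn -signr_odd.
  by move: p_odd; rewrite p1E /= => /negbTE ->; rewrite mul1r.
rewrite big_add1 big_mkord; apply: eq_bigr => i _ /=.
by rewrite subn1 /= subSS.
Qed.

(** * The isometry onto the extension *)

Definition split_map (v : g) : extAlgebra wa e := (w xs v, q v, w v x).
Definition split_map_inv (t : extAlgebra wa e) : g :=
  t.1.1 *: x + j t.1.2 + t.2 *: xs.

Lemma split_map_linear : linear split_map.
Proof.
move=> k u v; rewrite /split_map linearD linearZ !(bilfE wB).
by [].
Qed.

Lemma split_mapK : cancel split_map split_map_inv.
Proof. by move=> v; rewrite [RHS]decomp. Qed.

Lemma split_map_invK : cancel split_map_inv split_map.
Proof.
move=> [[k u] l]; rewrite /split_map /split_map_inv /= !(bilfE wB).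
rewrite !linearD !linearZ /= split_q_x split_q_xs jK.
rewrite wxsx wxx wxsxs wxsj wjx.
by rewrite !scaler0 !mulr0 !mulr1 !addr0 !add0r.
Qed.

Lemma split_map_part i v :
  v \in part g i -> split_map v \in part (extAlgebra wa e) i.
Proof.
case: i => vi; last by rewrite /= mem_ext_part0 split_q_part.
by rewrite /= mem_ext_part1 /= (wE xs0 vi).1 (wE x0 vi).2 eqxx split_q_part.
Qed.

Lemma split_map_inv_even t :
  t \in part (extAlgebra wa e) false -> split_map_inv t \in part g false.
Proof.
by rewrite /= mem_ext_part0 partE => t0; rewrite !memvD ?memvZ.
Qed.

Lemma split_map_br u v : split_map (br u v) = br (split_map u) (split_map v).
Proof.
rewrite {1}[u]decomp {1}[v]decomp.
have -> (y z : g) : br (split_map y) (split_map z) =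
    ext_br wa e (split_map y) (split_map z) by [].
rewrite /split_map /ext_br /= w_br_x split_eC !ZE.
(* With the coordinates generalised, the bracket table of x, xs and [j] decides everything. *)
move: (w xs u) (q u) (w u x) (w xs v) (q v) (w v x) => k y l k' y' l'.
rewrite !(bilDl brB) !(bilZl brB) !(bilDr brB) !(bilZr brB).
rewrite !(br_xj, br_jx, br_x_xs, br_xs_x, br_jxs, br_xsj, br_jj).
rewrite (even_br_self gL char2 x0) (even_br_self gL char2 xs0).
congr (_, _, _).
  rewrite !(bilfE wB) !wxsj wxsx /=.
  by rewrite -/lam; ring.
rewrite !(linearD, linearN, linearZ) /= !(linearD, linearN, linearZ) /=.
rewrite split_q_x !jK !(linear0, scaler0, oppr0, addr0, add0r).
by rewrite addrAC.
Qed.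

Lemma split_obtained : obtained_as_extension p pm w x pma wa e.
Proof.
pose F : 'Hom(g, extAlgebra wa e) := linfun split_map.
have FE v : F v = split_map v by apply/linear_linfunE/split_map_linear.
have FK : cancel F split_map_inv by move=> v; rewrite FE split_mapK.
have KF : cancel split_map_inv F by move=> v; rewrite FE split_map_invK.
have F_part i v : v \in part g i -> F v \in part (extAlgebra wa e) i.
  by rewrite FE; apply: split_map_part.
have F_br u v : F (br u v) = br (F u) (F v) by rewrite !FE split_map_br.
split; [exact: split_roqf | exact: split_ext_ok | exact: split_cases |].
exists (fun t => F (pm (split_map_inv t))); split.
- exact: (transport_p2p_map FK KF (F_part false) split_map_inv_even F_br
    (roqf_pm gR)).
- split=> [u u0||]; rewrite FE /split_map /split_map_inv /=.
  + by rewrite !scale0r add0r addr0 pm_perp ?wjx // -partE.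
  + by rewrite scale0r linear0 scale1r !add0r.
  + by rewrite scale0r linear0 scale1r !addr0.
exists F; split; last by rewrite FE /split_map wxsx wxx split_q_x.
split=> //.
- exact: Bijective FK KF.
- by move=> u u0; rewrite FK.
move=> u v; rewrite !FE /ext_form /= [u in RHS]decomp [v in RHS]decomp.
rewrite !(bilfE wB).
rewrite !(wxsj, wjx, wxj, wjxs, wxx, wxsxs, wxsx, wxxs) /wa.
by ring.
Qed.

End Extension.

(** * Existence of the extension *)

Section Main.
Variables (K : fieldType) (p : nat) (g : superAlgebra K).
Variables (pm : g -> g) (w : g -> g -> K).
Hypothesis charKp : p \in [pchar K].
Hypothesis p_gt2 : (2 < p)%N.
Hypothesis gR : restricted_orthosymplectic_qf p pm w.

Let gL := roqf_lie gR.
Let brB := br_bilinear gL.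
Let wQ := roqf_qf gR.
Let wB := qf_bilinear wQ.
Let wA := qf_antisym wQ.
Let wE := roqf_even gR.

Lemma br_in_derived (u v : g) : br u v \in derived_algebra g.
Proof.
rewrite (coord_vbasis (memvf u)) (coord_vbasis (memvf v)).
rewrite (big_morph (br^~ _) (fun y z => bilDl brB y z _) (bil0l brB _)).
apply: memv_suml => i _; rewrite (bilZl brB) memvZ //.
rewrite (big_morph (br _) (bilDr brB _) (bil0r brB _)).
apply: memv_suml => k _; rewrite (bilZr brB) memvZ // memv_span //.
by apply: allpairs_f; rewrite mem_nth // size_tuple.
Qed.

Lemma derived_orthogonal (v : g) :
  (forall u u', w v (br u u') = 0) -> orthogonal_to w (derived_algebra g) v.
Proof.
have wE' u : linfun (w v : g -> K^o) u = w v u by apply/linear_linfunE/wB.1.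
move=> v_br u u_der; suff: u \in lker (linfun (w v : g -> K^o)).
  by rewrite memv_ker wE' => /eqP.
apply: subvP u_der; apply/span_subvP => _ /allpairsP[[y z] [_ _ ->]].
by rewrite memv_ker wE' v_br.
Qed.

(** If x were orthogonal to a basis of the even part, evenness of w would put x in the radical. The
    minus sign in the witness undoes the swap of arguments. *)
Lemma dual_even_vector x : x \in part g false -> x != 0 ->
  exists2 xs, xs \in part g false & w xs x = 1.
Proof.
move=> x0 xN0.
pose b := vbasis (part g false).
have [i wi|w0] := pickP (fun i : 'I_(\dim (part g false)) => w x b`_i != 0).
  exists (- (w x b`_i)^-1 *: b`_i).
    by rewrite memvZ // vbasis_mem // mem_nth // size_tuple.
  rewrite (bilfZl wB) -[w b`_i x]opprK -(even_form_antisym gL wB wA x0).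
  by rewrite mulrNN mulVf.
case/eqP: xN0; apply: (qf_nondegenerate wQ) => v.
have [v0 [v1 [v00 v11 ->]]] := part_decomp gL v.
rewrite (bilfDr wB) (wE x0 v11).1 addr0 (coord_vbasis v00).
rewrite (big_morph (w x) (bilfDr wB x) (bilf0r wB x)) big1 // => i _.
by rewrite (bilfZr wB) (eqP (negbFE (w0 i))) mulr0.
Qed.

Lemma extension_exists x : x \in part g false -> x != 0 ->
  orthogonal_to w (derived_algebra g) x ->
  homogeneous_ideal (fun v => v \in <[x]>%VS) ->
  p_ideal pm (orthogonal_to w <[x]>%VS) ->
  exists (a : superAlgebra K) (pma : a -> a) (wa : a -> a -> K) (e : extData a),
    obtained_as_extension p pm w x pma wa e.
Proof.
move=> x0 xN0 x_der x_ideal x_perp.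
have [xs xs0 wxsx] := dual_even_vector x0 xN0.
have wxx := even_form_self charKp p_gt2 gR x0.
have wxsxs := even_form_self charKp p_gt2 gR xs0.
have w_x_br u v : w x (br u v) = 0 by apply/x_der/br_in_derived.
have br_x u : exists k, br u x = k *: x.
  by case: x_ideal => _ _ _ /(_ u x (memv_line x)) /vlineP.
have pm_perp u : u \in part g false -> w u x = 0 -> w (pm u) x = 0.
  move=> u0 ux; apply: (x_perp.2 u u0 _ x (memv_line x)) => v /vlineP[k ->].
  by rewrite (bilfZr wB) ux mulr0.
have [a [j [q aS]]] := splitting_exists wB wxx wxsxs wxsx.
have [Ds DsE] := split_adjoint_exists gR x0 xs0 w_x_br aS.
have [Z ZE] := split_Z_exists gR x0 xs0 w_x_br aS.
do 4!eexists.
exact: (split_obtained charKp p_gt2 gR x0 xs0 wxsx w_x_br br_x pm_perp aS DsE ZE).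
Qed.

Lemma span_homogeneous_ideal x : x \in part g false ->
  (forall u, br u x = 0) -> homogeneous_ideal (fun v => v \in <[x]>%VS).
Proof.
move=> x0 br_x; split=> [|k y z yx zx|y yx|y z /vlineP[k ->]].
- exact: mem0v.
- by rewrite memvD ?memvZ.
- exists y, 0; split; rewrite ?mem0v ?addr0 //.
  by case/vlineP: yx => k ->; rewrite memvZ.
by rewrite (bilZr brB) br_x scaler0 mem0v.
Qed.

Lemma orthogonal_homogeneous_ideal x : x \in part g false ->
  (forall u v, w (br u v) x = 0) ->
  homogeneous_ideal (orthogonal_to w <[x]>%VS).
Proof.
move=> x0 w_br_x.
have perpP v : orthogonal_to w <[x]>%VS v <-> w v x = 0.
  split=> [|vx u /vlineP[k ->]]; first by apply; apply: memv_line.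
  by rewrite (bilfZr wB) vx mulr0.
split=> [|k y z /perpP yx /perpP zx|y /perpP yx|y z _]; last first.
- exact/perpP.
- have [y0 [y1 [y00 y11 yE]]] := part_decomp gL y.
  have y1x : w y1 x = 0 := (wE x0 y11).2.
  exists y0, y1; split=> //; apply/perpP => //.
  by move: yx; rewrite yE (bilfDl wB) y1x addr0.
- by apply/perpP; rewrite !(bilfE wB) yx zx mulr0 addr0.
by apply/perpP; rewrite (bilf0l wB).
Qed.

(** Closedness on (x, u, v): the other two terms contain a bracket with x. *)
Lemma central_w_br x u v : x \in part g false -> in_center x -> w x (br u v) = 0.
Proof.
move=> x0 x_center.
have br_x y : br y x = 0.
  by apply/eqP; rewrite -oppr_eq0 -(even_br_antisym gL y x0) x_center.
elim/(part_ind gL): u => [u u' Hu Hu'|i u ui].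
  by rewrite (bilDl brB) (bilfDr wB) Hu Hu' addr0.
elim/(part_ind gL): v => [v v' Hv Hv'|i' v vi'].
  by rewrite (bilDr brB) (bilfDr wB) Hv Hv' addr0.
have := qf_closed wQ x0 ui vi'; rewrite x_center br_x.
by rewrite !(bilf0r wB) !mulr0 !addr0 mul1r.
Qed.

(** Pull x^* back to g: [x,x^*] has x-coordinate lambda, and x is central. *)
Lemma extension_lambda0 x (a : superAlgebra K) pma wa (e : extData a) :
  in_center x -> obtained_as_extension p pm w x pma wa e -> elambda e = 0.
Proof.
move=> x_center [aR _ _ [pme [_ _ [F [[[F' _ KF] _ F_br _ _] Fx]]]]].
have := F_br x (F' (0, 0, 1)); rewrite x_center linear0 KF Fx.
move/(congr1 (fun t : extSpace a => t.1.1)); rewrite /= /eC.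
have [aB _ _ _] := roqf_qf aR.
rewrite !(linear0, bilf0r aB, bilf0l aB).
by rewrite !(mulr0, mulr1, mul0r, subr0, addr0) => <-.
Qed.

End Main.

Theorem theorem3p2 (K : fieldType) (p : nat) (g : superAlgebra K)
    (pm : g -> g) (w : g -> g -> K) :
  p \in [pchar K] -> (2 < p)%N ->
  restricted_orthosymplectic_qf p pm w ->
  (forall x : g, x \in part g false -> x != 0 ->
     orthogonal_to w (derived_algebra g) x ->
     homogeneous_ideal (fun v => v \in <[x]>%VS) ->
     p_ideal pm (orthogonal_to w <[x]>%VS) ->
     exists (a : superAlgebra K) (pma : a -> a) (wa : a -> a -> K)
            (e : extData a),
       obtained_as_extension p pm w x pma wa e)
  /\
  (forall x : g, x \in part g false -> in_center x -> x != 0 ->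
     [/\ orthogonal_to w (derived_algebra g) x,
         homogeneous_ideal (fun v => v \in <[x]>%VS),
         homogeneous_ideal (orthogonal_to w <[x]>%VS)
       & p_ideal pm (orthogonal_to w <[x]>%VS) ->
         exists (a : superAlgebra K) (pma : a -> a) (wa : a -> a -> K)
                (e : extData a),
           obtained_as_extension p pm w x pma wa e /\ elambda e = 0]).
Proof.
move=> charKp p_gt2 gR; split=> [x|x x0 x_center xN0].
  exact: extension_exists charKp p_gt2 gR x.
have gL := roqf_lie gR.
have w_x_br u v : w x (br u v) = 0 by exact: (central_w_br gR u v x0 x_center).
have x_der := derived_orthogonal gR w_x_br.
have x_ideal : homogeneous_ideal (fun v => v \in <[x]>%VS).
  apply: (span_homogeneous_ideal gR x0) => u; apply/eqP.
  by rewrite -oppr_eq0 -(even_br_antisym gL u x0) x_center.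
split=> //.
  exact: (orthogonal_homogeneous_ideal gR x0 (w_br_x gR x0 w_x_br)).
move=> x_perp.
have [a [pma [wa [e eP]]]] :=
  extension_exists charKp p_gt2 gR x0 xN0 x_der x_ideal x_perp.
by exists a, pma, wa, e; split; last apply: extension_lambda0 x_center eP.
Qed.
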